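(* Let $n\ge2$, let $\lambda$ be a dominant integral weight, and let $r$ be an integer with $0\le r\le n$. Then the $MU(n)$-representation $L_{\lambda,r}=L_\lambda\otimes W_r$ is irreducible.
   Context: Let $K=\mathbb{C}(v)$ with $v$ an indeterminate, $n\ge2$, and for $1\le i,j\le n-1$ let $a_{ij}=2$ if $i=j$, $a_{ij}=-1$ if $|i-j|=1$, $a_{ij}=0$ if $|i-j|>1$. $U_v(\mathfrak{sl}_n)$ is the unital associative $K$-algebra with generators $e_i,f_i,k_i^{\pm1}$ ($1\le i\le n-1$) and relations: $k_ik_i^{-1}=k_i^{-1}k_i=1$, $k_ik_j=k_jk_i$; $k_ie_jk_i^{-1}=v^{a_{ij}}e_j$, $k_if_jk_i^{-1}=v^{-a_{ij}}f_j$; $e_if_j-f_je_i=\delta_{ij}\frac{k_i-k_i^{-1}}{v-v^{-1}}$; $e_ie_j=e_je_i$, $f_if_j=f_jf_i$ if $|i-j|\ne1$; $(v+v^{-1})e_ie_je_i=e_i^2e_j+e_je_i^2$ and $(v+v^{-1})f_if_jf_i=f_i^2f_j+f_jf_i^2$ if $|i-j|=1$. The mirabolic quantum group $MU(n)$ is the unital associative $K$-algebra with generators $\ell$ and $e_i,f_i,k_i^{\pm1}$ ($1\le i\le n-1$), subject to all the relations above together with: $\ell^2=\ell$, $k_i\ell=\ell k_i$; $\ell e_i=e_i\ell$, $\ell f_i=f_i\ell$ for $i\ge2$; $\ell e_1\ell=\ell e_1$, $\ell f_1\ell=f_1\ell$; $(v+v^{-1})e_1\ell e_1=v^{-1}e_1^2\ell+v\ell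 e_1^2$; $(v+v^{-1})f_1\ell f_1=v^{-1}\ell f_1^2+vf_1^2\ell$. There is an algebra map $\rho:MU(n)\to U_v(\mathfrak{sl}_n)\otimes MU(n)$ with $\rho(e_i)=1\otimes e_i+e_i\otimes k_i$, $\rho(f_i)=k_i^{-1}\otimes f_i+f_i\otimes1$, $\rho(k_i^{\pm1})=k_i^{\pm1}\otimes k_i^{\pm1}$, $\rho(\ell)=1\otimes\ell$. If $X$ is a $U_v(\mathfrak{sl}_n)$-module and $W$ an $MU(n)$-module, then $X\otimes W$ is an $MU(n)$-module via $\rho$. An (integral) weight is a class $\lambda\in\mathbb{Z}^n/\mathbb{Z}(1,\dots,1)$, written $\lambda=(\lambda_1,\dots,\lambda_n)$; it is dominant if $\lambda_1\ge\cdots\ge\lambda_n$. $L_\lambda$ is the simple finite dimensional $U_v(\mathfrak{sl}_n)$-module of highest weight $\lambda$ (of type $\mathbf 1$), generated by a vector $x_\lambda\neq 0$ with $e_ix_\lambda=0$, $k_ix_\lambda=v^{\lambda_i-\lambda_{i+1}}x_\lambda$. For $0\le r\le n$, $W_r=\wedge_v^r(K^n)$ is the $MU(n)$-module with basis $u_I$, $I\subset\{1,\dots,n\}$, $\#I=r$, and action: $k_iu_I=v\,u_I$ if $i\in I,i+1\notin I$; $k_iu_I=v^{-1}u_I$ if $i\notin I,i+1\in I$; $k_iu_I=u_I$ otherwise; $e_iu_I=u_{(I\setminus\{i+1\})\cup\{i\}}$ if $i+1\in I,i\notin I$, and $0$ otherwise; $f_iu_I=u_{(I\setminus\{i\})\cup\{i+1\}}$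 if $i\in I,i+1\notin I$, and $0$ otherwise; $\ell u_I=u_I$ if $1\notin I$ and $\ell u_I=0$ if $1\in I$. $L_{\lambda,r}:=L_\lambda\otimes W_r$, an $MU(n)$-module via $\rho$. *)

(* Defs.v *)
From HB Require Import structures.
From mathcomp Require Import all_boot all_order all_algebra fraction.
From mathcomp Require Import boolp reals.
From mathcomp Require Import complex mxtens.
From mathcomp Require Import finmap.
From mathcomp Require Import monalg.
From mathcomp Require Import ring zify.

Set Implicit Arguments.
Unset Strict Implicit.
Unset Printing Implicit Defensive.

Import GRing.Theory.
Local Open Scope ring_scope.
Local Open Scope quotient_scope.

(* {malg K[{fmonom G}]} is the free unital associative K-algebra on G. *)
Notation freealg K G := {malg K[{fmonom G}]}.

Definition fgen (K : fieldType) (G : choiceType) (g : G) : freealg K G :=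
  << fmu g >>.

Inductive two_sided_ideal (A : pzRingType) (rel : A -> A -> Prop) : A -> Prop :=
| ideal_rel x y : rel x y -> two_sided_ideal rel (x - y)
| ideal_0 : two_sided_ideal rel 0
| ideal_add x y : two_sided_ideal rel x -> two_sided_ideal rel y ->
    two_sided_ideal rel (x + y)
| ideal_mul a x b : two_sided_ideal rel x -> two_sided_ideal rel (a * x * b).

Section IdealPred.
Variables (A : pzRingType) (rel : A -> A -> Prop).

Definition ideal_pred : {pred A} := fun x => `[< two_sided_ideal rel x >].

Lemma ideal_zmod : zmod_closed ideal_pred.
Proof.
split; first exact/asboolP/ideal_0.
move=> x y /asboolP hx /asboolP hy; apply/asboolP/ideal_add => //.
by rewrite -[y]mulr1 -mulN1r mulrA; apply: ideal_mul.
Qed.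
HB.instance Definition _ := GRing.isZmodClosed.Build A ideal_pred ideal_zmod.

Lemma ideal_predM a x b : x \in ideal_pred -> a * x * b \in ideal_pred.
Proof. by move=> /asboolP hx; apply/asboolP/ideal_mul. Qed.

End IdealPred.

(* The algebra presented by the generators G and the relations rel, i.e. the
   quotient of the free algebra by the two-sided ideal of rel. *)
Definition presented (K : fieldType) (G : choiceType)
    (rel : freealg K G -> freealg K G -> Prop) : Type :=
  Quotient.quot (ideal_pred rel).

Lemma mulrB_split (A : pzRingType) (a b x y : A) :
  a * b - x * y = 1 * (a - x) * b + x * (b - y) * 1.
Proof. by rewrite mulr1 mul1r mulrBl mulrBr addrA subrK. Qed.

Section Presented.
Variables (K : fieldType) (G : choiceType).
Variable rel : freealg K G -> freealg K G -> Prop.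

Local Notation F := (freealg K G).
Local Notation Q := (Quotient.quot (ideal_pred rel)).
Local Notation P := (presented rel).

Definition pproj (x : F) : P := \pi_Q x.

Lemma pprojP x y : reflect (pproj x = pproj y) (x - y \in ideal_pred rel).
Proof. by rewrite Quotient.idealrBE; apply: eqP. Qed.

Lemma pproj_rel x y : rel x y -> pproj x = pproj y.
Proof. by move=> h; apply/pprojP/asboolP/ideal_rel. Qed.

Definition prepr (x : P) : F := repr (x : Q).

Lemma preprK x : pproj (prepr x) = x.
Proof. exact: reprK. Qed.

Lemma pprojK x : prepr (pproj x) - x \in ideal_pred rel.
Proof. by apply/pprojP; rewrite preprK. Qed.

HB.instance Definition _ := GRing.Zmodule.copy P Q.

Lemma pprojD x y : pproj (x + y) = pproj x + pproj y.
Proof. by rewrite /pproj !piE. Qed.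

Definition pone : P := pproj 1.
Definition pmul (x y : P) : P := pproj (prepr x * prepr y).
Definition pscale (c : K) (x : P) : P := pproj (c *: prepr x).

Lemma pprojM x y : pproj (x * y) = pmul (pproj x) (pproj y).
Proof.
apply/esym/pprojP.
rewrite mulrB_split.
by rewrite rpredD // ideal_predM // pprojK.
Qed.

Lemma pprojZ c x : pproj (c *: x) = pscale c (pproj x).
Proof.
apply/esym/pprojP; rewrite -scalerBr -[_ - x]mul1r scalerAl -[X in X \in _]mulr1.
by rewrite ideal_predM // pprojK.
Qed.

Lemma pmulA : associative pmul.
Proof.
by move=> x y z; rewrite -[x]preprK -[y]preprK -[z]preprK -!pprojM mulrA.
Qed.
Lemma pmul1 : left_id pone pmul.
Proof. by move=> x; rewrite -[x]preprK -pprojM mul1r. Qed.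
Lemma pmulr1 : right_id pone pmul.
Proof. by move=> x; rewrite -[x]preprK -pprojM mulr1. Qed.
Lemma pmulDl : left_distributive pmul +%R.
Proof.
move=> x y z; rewrite -[x]preprK -[y]preprK -[z]preprK.
by rewrite -pprojD -!pprojM mulrDl pprojD.
Qed.
Lemma pmulDr : right_distributive pmul +%R.
Proof.
move=> x y z; rewrite -[x]preprK -[y]preprK -[z]preprK.
by rewrite -pprojD -!pprojM mulrDr pprojD.
Qed.
HB.instance Definition _ :=
  GRing.Zmodule_isPzRing.Build P pmulA pmul1 pmulr1 pmulDl pmulDr.

Lemma pscaleA a b x : pscale a (pscale b x) = pscale (a * b) x.
Proof. by rewrite -[x]preprK -!pprojZ scalerA. Qed.
Lemma pscale1 : left_id 1 pscale.
Proof. by move=> x; rewrite -[x]preprK -pprojZ scale1r. Qed.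
Lemma pscaleDr : right_distributive pscale +%R.
Proof.
by move=> c x y; rewrite -[x]preprK -[y]preprK -pprojD -!pprojZ scalerDr pprojD.
Qed.
Lemma pscaleDl x : {morph pscale^~ x : a b / a + b}.
Proof. by move=> a b; rewrite -[x]preprK -!pprojZ scalerDl pprojD. Qed.
HB.instance Definition _ :=
  GRing.Zmodule_isLmodule.Build K P pscaleA pscale1 pscaleDr pscaleDl.

Lemma pscaleAl (c : K) (x y : P) : c *: (x * y) = (c *: x) * y.
Proof.
rewrite -[x]preprK -[y]preprK.
change (pscale c (pmul (pproj (prepr x)) (pproj (prepr y))) =
  pmul (pscale c (pproj (prepr x))) (pproj (prepr y))).
by rewrite -pprojZ -!pprojM -pprojZ scalerAl.
Qed.

Lemma pproj_is_zmod : zmod_morphism pproj.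
Proof. by move=> x y; rewrite /pproj !piE. Qed.
HB.instance Definition _ := GRing.isZmodMorphism.Build F P pproj pproj_is_zmod.
Lemma pproj_is_monoid : monoid_morphism pproj.
Proof. split; [reflexivity|exact: pprojM]. Qed.
HB.instance Definition _ :=
  GRing.isMonoidMorphism.Build F P pproj pproj_is_monoid.
HB.instance Definition _ :=
  GRing.isScalable.Build K F P *:%R pproj pprojZ.

Definition pgen (g : G) : P := pproj (fgen K g).

End Presented.

Section FreeLift.
Variables (K : fieldType) (G : choiceType) (m : nat) (h : G -> 'M[K]_m).

Definition word_lift (w : {fmonom G}) : 'M[K]_m := \prod_(g <- (w : seq G)) h g.

Definition free_lift (x : freealg K G) : 'M[K]_m :=
  \sum_(w <- msupp x) x@_w *: word_lift w.

Lemma free_liftEw (d : {fset {fmonom G}}) x : (msupp x `<=` d)%fset ->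
  free_lift x = \sum_(w <- d) x@_w *: word_lift w.
Proof.
move=> le; rewrite [LHS](big_fset_incl _ le) => //= w wd /mcoeff_outdom ->.
by rewrite scale0r.
Qed.

Lemma free_liftU c w : free_lift << c *g w >> = c *: word_lift w.
Proof. by rewrite (free_liftEw msuppU_le) big_seq_fset1 mcoeffUU. Qed.

Lemma free_lift_is_zmod : zmod_morphism free_lift.
Proof.
move=> x y.
rewrite (free_liftEw (fsubset_trans (msuppB_le x y) (fsubset_refl _))).
rewrite (free_liftEw (fsubsetUl (msupp x) (msupp y))).
rewrite (free_liftEw (fsubsetUr (msupp x) (msupp y))) -sumrB.
by apply: eq_bigr => w _; rewrite mcoeffB scalerBl.
Qed.
HB.instance Definition _ :=
  GRing.isZmodMorphism.Build (freealg K G) 'M[K]_m free_lift free_lift_is_zmod.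

Lemma word_liftM v w : word_lift (mmul v w) = word_lift v * word_lift w.
Proof. by rewrite /word_lift fmM big_cat. Qed.

Lemma free_lift_is_monoid : monoid_morphism free_lift.
Proof.
split.
  by rewrite free_liftU /word_lift fm1 big_nil scale1r.
move=> x y; rewrite malgME raddf_sum mulr_suml /=; apply: eq_bigr => u _.
rewrite raddf_sum mulr_sumr /=; apply: eq_bigr => w _.
by rewrite free_liftU word_liftM -scalerA scalemxAr scalemxAl.
Qed.
HB.instance Definition _ :=
  GRing.isMonoidMorphism.Build (freealg K G) 'M[K]_m free_lift
    free_lift_is_monoid.

Lemma free_liftZ c x : free_lift (c *: x) = c *: free_lift x.
Proof.
rewrite (free_liftEw (msuppZ_le _ _)) /free_lift scaler_sumr.
by apply: eq_bigr => w _; rewrite mcoeffZ scalerA.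
Qed.
HB.instance Definition _ :=
  GRing.isScalable.Build K (freealg K G) 'M[K]_m *:%R free_lift free_liftZ.

Lemma free_lift_gen g : free_lift (fgen K g) = h g.
Proof. by rewrite free_liftU /word_lift fmU big_seq1 scale1r. Qed.

End FreeLift.

Lemma free_lift_uniq (K : fieldType) (G : choiceType) m
    (V : {rmorphism freealg K G -> 'M[K]_m}) :
    (forall c x, V (c *: x) = c *: V x) ->
  forall x, V x = free_lift (fun g => V (fgen K g)) x.
Proof.
move=> VZ x; rewrite [in LHS](monalgE x) rmorph_sum /=.
apply: eq_bigr => w _.
have -> : << x@_w *g w >> = x@_w *: (<< w >> : freealg K G).
  by apply/malgP => w'; rewrite mcoeffZ !mcoeffU mulrnAr mulr1.
rewrite VZ; congr (_ *: _).
rewrite /word_lift; case: w => s /=; elim: s => [|g s IH].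
  rewrite big_nil -(rmorph1 V); congr (V _); congr << _ >>.
  by apply/eqP; rewrite -val_eqE /= fm1.
rewrite big_cons -IH -rmorphM; congr (V _).
rewrite /fgen -[RHS]/(fgmul _ _) fgmulUU mulr1; congr << _ >>.
by apply/eqP; rewrite -val_eqE /= fmM fmU.
Qed.

Section PresentedLift.
Variables (K : fieldType) (G : choiceType) (m : nat).
Variable rel : freealg K G -> freealg K G -> Prop.
Variable h : G -> 'M[K]_m.
Hypothesis hrel : forall x y, rel x y -> free_lift h x = free_lift h y.

Local Notation P := (presented rel).

Lemma free_lift_ideal x : x \in ideal_pred rel -> free_lift h x = 0.
Proof.
move=> /asboolP; elim=> {x}.
- by move=> x y /hrel; rewrite raddfB /= => ->; rewrite subrr.
- by rewrite raddf0.
- by move=> x y _ hx _ hy; rewrite raddfD /= hx hy addr0.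
- by move=> a x b _ hx; rewrite !rmorphM /= hx mulr0 mul0r.
Qed.

Definition presented_lift (x : P) : 'M[K]_m := free_lift h (prepr x).

Lemma presented_liftE x : presented_lift (pproj rel x) = free_lift h x.
Proof.
by apply/eqP; rewrite -subr_eq0 -raddfB /= free_lift_ideal // pprojK.
Qed.

Lemma presented_lift_is_zmod : zmod_morphism presented_lift.
Proof.
move=> x y; rewrite -[x]preprK -[y]preprK /=.
by rewrite -raddfB !presented_liftE raddfB.
Qed.
HB.instance Definition _ :=
  GRing.isZmodMorphism.Build P 'M[K]_m presented_lift presented_lift_is_zmod.

Lemma presented_lift_is_monoid : monoid_morphism presented_lift.
Proof.
split; first by rewrite presented_liftE rmorph1.
move=> x y; rewrite -[x]preprK -[y]preprK /=.
by rewrite -[_ * _](pprojM rel) !presented_liftE rmorphM.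
Qed.
HB.instance Definition _ :=
  GRing.isMonoidMorphism.Build P 'M[K]_m presented_lift presented_lift_is_monoid.

Lemma presented_liftZ c x : presented_lift (c *: x) = c *: presented_lift x.
Proof.
rewrite -[x]preprK -[_ *: _](pprojZ rel) !presented_liftE.
exact: free_liftZ.
Qed.
HB.instance Definition _ :=
  GRing.isScalable.Build K P 'M[K]_m *:%R presented_lift presented_liftZ.

Lemma presented_lift_gen g : presented_lift (pgen rel g) = h g.
Proof. by rewrite presented_liftE free_lift_gen. Qed.

End PresentedLift.

Definition adjacent n (i j : 'I_n) := (i == j.+1 :> nat) || (j == i.+1 :> nat).

Definition cartan n (i j : 'I_n) : int :=
  if i == j then 2 else if adjacent i j then -1 else 0.

(* Indices are shifted by one throughout: i : 'I_n.-1 stands for the index i + 1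
   of e, f, k, and x : 'I_n for the element x + 1 of {1, ..., n}. *)
Inductive ugen (n : nat) :=
| Ue of 'I_n.-1 | Uf of 'I_n.-1 | Uk of 'I_n.-1 | Uki of 'I_n.-1.

Section UgenChoice.
Variable n : nat.
Definition ugen_code (g : ugen n) : nat * 'I_n.-1 :=
  match g with
  | Ue i => (0%N, i) | Uf i => (1%N, i) | Uk i => (2%N, i) | Uki i => (3%N, i)
  end.
Definition ugen_decode (c : nat * 'I_n.-1) : ugen n :=
  match c.1 with
  | 0 => Ue c.2 | 1 => Uf c.2 | 2 => Uk c.2 | _ => Uki c.2
  end.
Lemma ugen_codeK : cancel ugen_code ugen_decode. Proof. by case. Qed.
HB.instance Definition _ := Choice.copy (ugen n) (can_type ugen_codeK).
End UgenChoice.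

Section Relations.
Variables (K : fieldType) (v : K) (n : nat).

Section Urel.
Variables (A : lalgType K) (g : ugen n -> A).
Local Notation e i := (g (Ue i)).
Local Notation f i := (g (Uf i)).
Local Notation k i := (g (Uk i)).
Local Notation ki i := (g (Uki i)).

Inductive U_rel : A -> A -> Prop :=
| U_kki i : U_rel (k i * ki i) 1
| U_kik i : U_rel (ki i * k i) 1
| U_kk i j : U_rel (k i * k j) (k j * k i)
| U_ke i j : U_rel (k i * e j * ki i) (v ^ cartan i j *: e j)
| U_kf i j : U_rel (k i * f j * ki i) (v ^ (- cartan i j) *: f j)
| U_ef i j : U_rel (e i * f j - f j * e i)
    (if i == j then (v - v^-1)^-1 *: (k i - ki i) else 0)
| U_ee i j : ~~ adjacent i j -> U_rel (e i * e j) (e j * e i)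
| U_ff i j : ~~ adjacent i j -> U_rel (f i * f j) (f j * f i)
| U_serre_e i j : adjacent i j ->
    U_rel ((v + v^-1) *: (e i * e j * e i)) (e i ^+ 2 * e j + e j * e i ^+ 2)
| U_serre_f i j : adjacent i j ->
    U_rel ((v + v^-1) *: (f i * f j * f i)) (f i ^+ 2 * f j + f j * f i ^+ 2).

End Urel.

(* The generator [None] of MU(n) is l. *)
Section MUrel.
Variables (A : lalgType K) (g : option (ugen n) -> A).
Local Notation e i := (g (Some (Ue i))).
Local Notation f i := (g (Some (Uf i))).
Local Notation k i := (g (Some (Uk i))).
Local Notation l := (g None).

Inductive MU_rel : A -> A -> Prop :=
| MU_U x y : U_rel (fun u => g (Some u)) x y -> MU_rel x y
| MU_ll : MU_rel (l ^+ 2) l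
| MU_kl i : MU_rel (k i * l) (l * k i)
| MU_le (i : 'I_n.-1) : (0 < i)%N -> MU_rel (l * e i) (e i * l)
| MU_lf (i : 'I_n.-1) : (0 < i)%N -> MU_rel (l * f i) (f i * l)
| MU_lel (i : 'I_n.-1) : i = 0%N :> nat -> MU_rel (l * e i * l) (l * e i)
| MU_lfl (i : 'I_n.-1) : i = 0%N :> nat -> MU_rel (l * f i * l) (f i * l)
| MU_ele (i : 'I_n.-1) : i = 0%N :> nat ->
    MU_rel ((v + v^-1) *: (e i * l * e i))
           (v^-1 *: (e i ^+ 2 * l) + v *: (l * e i ^+ 2))
| MU_flf (i : 'I_n.-1) : i = 0%N :> nat ->
    MU_rel ((v + v^-1) *: (f i * l * f i))
           (v^-1 *: (l * f i ^+ 2) + v *: (f i ^+ 2 * l)).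

End MUrel.

Definition Uq := presented (U_rel (@fgen K (ugen n))).
Definition MUq := presented (MU_rel (@fgen K (option (ugen n)))).

(* The relations as matrix identities; matrix algebras of unknown size are not
   instances of [lalgType], since they may be trivial. *)
Section MatrixRelations.
Variable m : nat.

Record U_mxrel (h : ugen n -> 'M[K]_m) : Prop := UMxrel {
  mx_kki : forall i, h (Uk i) *m h (Uki i) = 1%:M;
  mx_kik : forall i, h (Uki i) *m h (Uk i) = 1%:M;
  mx_kk : forall i j, h (Uk i) *m h (Uk j) = h (Uk j) *m h (Uk i);
  mx_ke : forall i j,
    h (Uk i) *m h (Ue j) *m h (Uki i) = v ^ cartan i j *: h (Ue j);
  mx_kf : forall i j,
    h (Uk i) *m h (Uf j) *m h (Uki i) = v ^ (- cartan i j) *: h (Uf j);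
  mx_ef : forall i j, h (Ue i) *m h (Uf j) - h (Uf j) *m h (Ue i) =
    if i == j then (v - v^-1)^-1 *: (h (Uk i) - h (Uki i)) else 0;
  mx_ee : forall i j, ~~ adjacent i j ->
    h (Ue i) *m h (Ue j) = h (Ue j) *m h (Ue i);
  mx_ff : forall i j, ~~ adjacent i j ->
    h (Uf i) *m h (Uf j) = h (Uf j) *m h (Uf i);
  mx_serre_e : forall i j, adjacent i j ->
    (v + v^-1) *: (h (Ue i) *m h (Ue j) *m h (Ue i)) =
    h (Ue i) *m h (Ue i) *m h (Ue j) + h (Ue j) *m (h (Ue i) *m h (Ue i));
  mx_serre_f : forall i j, adjacent i j ->
    (v + v^-1) *: (h (Uf i) *m h (Uf j) *m h (Uf i)) =
    h (Uf i) *m h (Uf i) *m h (Uf j) + h (Uf j) *m (h (Uf i) *m h (Uf i))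
}.

Record MU_mxrel (h : option (ugen n) -> 'M[K]_m) : Prop := MUMxrel {
  mx_U : U_mxrel (fun u => h (Some u));
  mx_ll : h None *m h None = h None;
  mx_kl : forall i, h (Some (Uk i)) *m h None = h None *m h (Some (Uk i));
  mx_le : forall i : 'I_n.-1, (0 < i)%N ->
    h None *m h (Some (Ue i)) = h (Some (Ue i)) *m h None;
  mx_lf : forall i : 'I_n.-1, (0 < i)%N ->
    h None *m h (Some (Uf i)) = h (Some (Uf i)) *m h None;
  mx_lel : forall i : 'I_n.-1, i = 0%N :> nat ->
    h None *m h (Some (Ue i)) *m h None = h None *m h (Some (Ue i));
  mx_lfl : forall i : 'I_n.-1, i = 0%N :> nat ->
    h None *m h (Some (Uf i)) *m h None = h (Some (Uf i)) *m h None;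
  mx_ele : forall i : 'I_n.-1, i = 0%N :> nat ->
    (v + v^-1) *: (h (Some (Ue i)) *m h None *m h (Some (Ue i))) =
    v^-1 *: (h (Some (Ue i)) *m h (Some (Ue i)) *m h None) +
    v *: (h None *m (h (Some (Ue i)) *m h (Some (Ue i))));
  mx_flf : forall i : 'I_n.-1, i = 0%N :> nat ->
    (v + v^-1) *: (h (Some (Uf i)) *m h None *m h (Some (Uf i))) =
    v^-1 *: (h None *m (h (Some (Uf i)) *m h (Some (Uf i)))) +
    v *: (h (Some (Uf i)) *m h (Some (Uf i)) *m h None)
}.

Section Morphism.
Variables (A : lalgType K) (phi : {lrmorphism A -> 'M[K]_m | *:%R}).

Let phiM : {morph phi : x y / x * y >-> x *m y}. Proof. exact: rmorphM. Qed.
Let phi1 : phi 1 = 1%:M. Proof. exact: rmorph1. Qed.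
Let phiZ c : {morph phi : x / c *: x}.
Proof. by move=> x; exact: linearZ_LR. Qed.
Let phi0 : phi 0 = 0. Proof. exact: raddf0. Qed.
Let phiB : {morph phi : x y / x - y}. Proof. exact: raddfB. Qed.
Let phiD : {morph phi : x y / x + y}. Proof. exact: raddfD. Qed.
Let phiE := (phi0, phi1, phiB, phiD, phiM, phiZ).

Lemma U_rel_morph (g : ugen n -> A) :
  (forall x y, U_rel g x y -> phi x = phi y) <-> U_mxrel (fun u => phi (g u)).
Proof.
split=> [H|[kki kik kk ke kf ef ee ff se sf] x y].
  split=> [i|i|i j|i j|i j|i j|i j a|i j a|i j a|i j a].
  - by have := H _ _ (U_kki _ i); rewrite !phiE.
  - by have := H _ _ (U_kik _ i); rewrite !phiE.
  - by have := H _ _ (U_kk _ i j); rewrite !phiE.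
  - by have := H _ _ (U_ke _ i j); rewrite !phiE.
  - by have := H _ _ (U_kf _ i j); rewrite !phiE.
  - by have := H _ _ (U_ef _ i j); rewrite !phiE => ->; case: eqP; rewrite ?phiE.
  - by have := H _ _ (U_ee _ a); rewrite !phiE.
  - by have := H _ _ (U_ff _ a); rewrite !phiE.
  - by have := H _ _ (U_serre_e _ a); rewrite !expr2 !phiE.
  - by have := H _ _ (U_serre_f _ a); rewrite !expr2 !phiE.
case=> [i|i|i j|i j|i j|i j|i j|i j|i j|i j]; rewrite ?expr2 ?phiE; auto.
by rewrite ef; case: eqP; rewrite ?phiE.
Qed.

Lemma MU_rel_morph (g : option (ugen n) -> A) :
  (forall x y, MU_rel g x y -> phi x = phi y) <-> MU_mxrel (fun u => phi (g u)).
Proof.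
split=> [H|[U ll kl le lf lel lfl ele flf] x y].
  split=> [||i|i a|i a|i a|i a|i a|i a].
  - by apply/U_rel_morph => x y r; apply: H; apply: MU_U.
  - by have := H _ _ (MU_ll _); rewrite !expr2 !phiE.
  - by have := H _ _ (MU_kl _ i); rewrite !phiE.
  - by have := H _ _ (MU_le _ a); rewrite !phiE.
  - by have := H _ _ (MU_lf _ a); rewrite !phiE.
  - by have := H _ _ (MU_lel _ a); rewrite !phiE.
  - by have := H _ _ (MU_lfl _ a); rewrite !phiE.
  - by have := H _ _ (MU_ele _ a); rewrite !expr2 !phiE.
  - by have := H _ _ (MU_flf _ a); rewrite !expr2 !phiE.
case=> [{}x {}y||i|i|i|i|i|i|i]; last first.
1-8: by rewrite ?expr2 ?phiE; auto.
by move: x y; apply/U_rel_morph.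
Qed.

End Morphism.

Lemma U_mxrel_lift (h : ugen n -> 'M[K]_m) x y :
  U_mxrel h -> U_rel (@fgen K _) x y -> free_lift h x = free_lift h y.
Proof.
move=> H; move: x y; apply/(U_rel_morph (free_lift h)).
by under eq_fun do rewrite /= free_lift_gen.
Qed.

Lemma MU_mxrel_lift (h : option (ugen n) -> 'M[K]_m) x y :
  MU_mxrel h -> MU_rel (@fgen K _) x y -> free_lift h x = free_lift h y.
Proof.
move=> H; move: x y; apply/(MU_rel_morph (free_lift h)).
by under eq_fun do rewrite /= free_lift_gen.
Qed.

End MatrixRelations.

(* The trivial representation, used to see that Uq and MUq are nonzero. *)
Definition trivial_gen (u : ugen n) : 'M[K]_1 :=
  match u with Ue _ | Uf _ => 0 | Uk _ | Uki _ => 1%:M end.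

Lemma trivial_U : U_mxrel trivial_gen.
Proof.
split=> * /=; rewrite ?(mulmx1, mulmx0, mul0mx, subrr, scaler0, addr0) //.
by rewrite if_same.
Qed.

Definition trivial_mgen (u : option (ugen n)) : 'M[K]_1 :=
  if u is Some u then trivial_gen u else 1%:M.

Lemma trivial_MU : MU_mxrel trivial_mgen.
Proof.
split=> [|*|*|*|*|*|*|*|*] /=; first exact: trivial_U.
all: by rewrite ?(mulmx1, mulmx0, mul0mx, subrr, scaler0, addr0).
Qed.

HB.instance Definition _ :=
  GRing.Lmodule.copy Uq (presented (U_rel (@fgen K (ugen n)))).
HB.instance Definition _ :=
  GRing.PzRing.copy Uq (presented (U_rel (@fgen K (ugen n)))).
HB.instance Definition _ :=
  GRing.Lmodule.copy MUq (presented (MU_rel (@fgen K (option (ugen n))))).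
HB.instance Definition _ :=
  GRing.PzRing.copy MUq (presented (MU_rel (@fgen K (option (ugen n))))).

Lemma Uq_neq0 : 1 != 0 :> Uq.
Proof.
apply/eqP => h.
have r x y : U_rel (@fgen K (ugen n)) x y ->
    free_lift trivial_gen x = free_lift trivial_gen y.
  exact: (U_mxrel_lift trivial_U).
have h' : pproj (U_rel (@fgen K _)) 1 = pproj (U_rel (@fgen K _)) 0.
  by rewrite [RHS]rmorph0; exact: h.
have := congr1 (presented_lift trivial_gen) h'.
rewrite !(presented_liftE r) rmorph0 (rmorph1 (free_lift _)) => /eqP.
by rewrite oner_eq0.
Qed.
HB.instance Definition _ := GRing.PzSemiRing_isNonZero.Build Uq Uq_neq0.
HB.instance Definition _ := GRing.Lmodule_isLalgebra.Build K Uq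
  (@pscaleAl K _ (U_rel (@fgen K (ugen n)))).

Lemma MUq_neq0 : 1 != 0 :> MUq.
Proof.
apply/eqP => h.
have r x y : MU_rel (@fgen K (option (ugen n))) x y ->
    free_lift trivial_mgen x = free_lift trivial_mgen y.
  exact: (MU_mxrel_lift trivial_MU).
have h' : pproj (MU_rel (@fgen K _)) 1 = pproj (MU_rel (@fgen K _)) 0.
  by rewrite [RHS]rmorph0; exact: h.
have := congr1 (presented_lift trivial_mgen) h'.
rewrite !(presented_liftE r) rmorph0 (rmorph1 (free_lift _)) => /eqP.
by rewrite oner_eq0.
Qed.
HB.instance Definition _ := GRing.PzSemiRing_isNonZero.Build MUq MUq_neq0.
HB.instance Definition _ := GRing.Lmodule_isLalgebra.Build K MUq
  (@pscaleAl K _ (MU_rel (@fgen K (option (ugen n))))).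

Definition Ugen (u : ugen n) : Uq := pgen _ u.
Definition MUgen (u : option (ugen n)) : MUq := pgen _ u.


Definition projU : freealg K (ugen n) -> Uq := pproj _.
HB.instance Definition _ :=
  GRing.isZmodMorphism.Build _ Uq projU (@pproj_is_zmod _ _ _).
HB.instance Definition _ :=
  GRing.isMonoidMorphism.Build _ Uq projU (@pproj_is_monoid _ _ _).
HB.instance Definition _ :=
  GRing.isScalable.Build K _ Uq *:%R projU (@pprojZ _ _ _).

Definition projMU : freealg K (option (ugen n)) -> MUq := pproj _.
HB.instance Definition _ :=
  GRing.isZmodMorphism.Build _ MUq projMU (@pproj_is_zmod _ _ _).
HB.instance Definition _ :=
  GRing.isMonoidMorphism.Build _ MUq projMU (@pproj_is_monoid _ _ _).
HB.instance Definition _ :=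
  GRing.isScalable.Build K _ MUq *:%R projMU (@pprojZ _ _ _).

Lemma U_mxrelP (m : nat) (V : {lrmorphism Uq -> 'M[K]_m | *:%R}) :
  U_mxrel (fun u => V (Ugen u)).
Proof.
apply/(U_rel_morph (V \o projU)) => x y h /=.
by congr (V _); apply: pproj_rel.
Qed.

Lemma MU_mxrelP (m : nat) (V : {lrmorphism MUq -> 'M[K]_m | *:%R}) :
  MU_mxrel (fun u => V (MUgen u)).
Proof.
apply/(MU_rel_morph (V \o projMU)) => x y h /=.
by congr (V _); apply: pproj_rel.
Qed.

End Relations.

(* A finite-dimensional representation, on a space of column vectors. *)
Record rep (K : fieldType) (A : lalgType K) := Rep {
  rdim : nat;
  ract :> {lrmorphism A -> 'M[K]_rdim | *:%R}
}.

Definition irreducible_rep (K : fieldType) (A : lalgType K) (V : rep A) : Prop :=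
  (0 < rdim V)%N /\
  forall U : {vspace 'cV[K]_(rdim V)},
    (forall a u, u \in U -> V a *m u \in U) -> U = 0%VS \/ U = fullv.

Section MULift.
Variables (K : fieldType) (v : K) (n m : nat) (h : option (ugen n) -> 'M[K]_m).
Hypothesis H : MU_mxrel v h.

Definition MU_lift of MU_mxrel v h : MUq v n -> 'M[K]_m := presented_lift h.
Let r x y := @MU_mxrel_lift K v n m h x y H.
HB.instance Definition _ :=
  GRing.isZmodMorphism.Build _ _ (MU_lift H) (presented_lift_is_zmod r).
HB.instance Definition _ :=
  GRing.isMonoidMorphism.Build _ _ (MU_lift H) (presented_lift_is_monoid r).
HB.instance Definition _ :=
  GRing.isScalable.Build _ _ _ *:%R (MU_lift H) (presented_liftZ r).

Definition MU_rep : rep (MUq v n) := Rep (MU_lift H).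

Lemma MU_rep_gen u : MU_rep (MUgen v u) = h u.
Proof. exact: presented_lift_gen. Qed.

End MULift.

Section Tensor.
Variables (K : fieldType) (v : K) (n : nat).
Hypothesis v_neq0 : v != 0.

Lemma serre_sum m (a b c d : 'M[K]_m) :
  b *m a = v ^+ 2 *: (a *m b) -> b *m c = v^-1 *: (c *m b) ->
  d *m a = v^-1 *: (a *m d) ->
  (v + v^-1) *: (a *m c *m a) = a *m a *m c + c *m (a *m a) ->
  (v + v^-1) *: (b *m d *m b) = b *m b *m d + d *m (b *m b) ->
  (v + v^-1) *: ((a + b) *m (c + d) *m (a + b)) =
  (a + b) *m (a + b) *m (c + d) + (c + d) *m ((a + b) *m (a + b)).
Proof.
move=> ba bc da; rewrite !(mulmxDl, mulmxDr) !mulmxA => Sa Sb.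
have ba' x : x *m b *m a = v ^+ 2 *: (x *m a *m b).
  by rewrite -mulmxA ba -scalemxAr mulmxA.
have bc' x : x *m b *m c = v^-1 *: (x *m c *m b).
  by rewrite -mulmxA bc -scalemxAr mulmxA.
have da' x : x *m d *m a = v^-1 *: (x *m a *m d).
  by rewrite -mulmxA da -scalemxAr mulmxA.
rewrite !(scalerDr, Sa, Sb) !(ba, bc, da, ba', bc', da', =^~ scalemxAl, scalerA).
move: (a *m a *m c) (c *m a *m a) (a *m a *m d) (a *m c *m b) (c *m a *m b)
  (a *m d *m b) (a *m b *m d) (c *m b *m b) (b *m b *m d) (d *m b *m b).
move=> x1 x2 x3 x4 x5 x6 x7 x8 x9 x10.
by apply/matrixP => i j; rewrite !mxE; field.
Qed.

Lemma ele_sum m (a b l : 'M[K]_m) :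
  b *m a = v ^+ 2 *: (a *m b) -> b *m l = l *m b ->
  (v + v^-1) *: (a *m l *m a) = v^-1 *: (a *m a *m l) + v *: (l *m (a *m a)) ->
  (v + v^-1) *: ((a + b) *m l *m (a + b)) =
  v^-1 *: ((a + b) *m (a + b) *m l) + v *: (l *m ((a + b) *m (a + b))).
Proof.
move=> ba bl; rewrite !(mulmxDl, mulmxDr) !mulmxA => Sa.
have ba' x : x *m b *m a = v ^+ 2 *: (x *m a *m b).
  by rewrite -mulmxA ba -scalemxAr mulmxA.
have bl' x : x *m b *m l = x *m l *m b by rewrite -mulmxA bl mulmxA.
rewrite !(scalerDr, Sa) !(ba, bl, ba', bl', =^~ scalemxAl, scalerA).
move: (a *m a *m l) (l *m a *m a) (a *m l *m b) (l *m a *m b) (l *m b *m b).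
move=> x1 x2 x3 x4 x5.
by apply/matrixP => i j; rewrite !mxE; field.
Qed.

Lemma flf_sum m (a b l : 'M[K]_m) :
  b *m a = v ^+ 2 *: (a *m b) -> a *m l = l *m a ->
  (v + v^-1) *: (b *m l *m b) = v^-1 *: (l *m (b *m b)) + v *: (b *m b *m l) ->
  (v + v^-1) *: ((a + b) *m l *m (a + b)) =
  v^-1 *: (l *m ((a + b) *m (a + b))) + v *: ((a + b) *m (a + b) *m l).
Proof.
move=> ba al; rewrite !(mulmxDl, mulmxDr) !mulmxA => Sb.
have ba' x : x *m b *m a = v ^+ 2 *: (x *m a *m b).
  by rewrite -mulmxA ba -scalemxAr mulmxA.
have al' x : x *m a *m l = x *m l *m a by rewrite -mulmxA al mulmxA.
have bla : b *m l *m a = v ^+ 2 *: (a *m b *m l).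
  by rewrite -mulmxA -al mulmxA ba -scalemxAl.
rewrite !(scalerDr, Sb) !(bla, ba, al, ba', al', =^~ scalemxAl, scalerA).
move: (l *m b *m b) (b *m b *m l) (l *m a *m a) (l *m a *m b) (a *m b *m l).
move=> x1 x2 x3 x4 x5.
by apply/matrixP => i j; rewrite !mxE; field.
Qed.

Lemma tens1 m p : (1%:M : 'M[K]_m) *t (1%:M : 'M[K]_p) = 1%:M.
Proof.
apply/matrixP => i j.
case: (mxtens_indexP i) => i0 i1; case: (mxtens_indexP j) => j0 j1.
rewrite tensmxE !mxE -natrM mulnb; congr ((nat_of_bool _)%:R).
by rewrite (inj_eq (can_inj (@mxtens_indexK _ _))) xpair_eqE.
Qed.

Lemma tensZl m p q r c (A : 'M[K]_(m, p)) (B : 'M[K]_(q, r)) :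
  (c *: A) *t B = c *: (A *t B).
Proof. by apply/matrixP => i j; rewrite !mxE mulrA. Qed.
Lemma tensZr m p q r c (A : 'M[K]_(m, p)) (B : 'M[K]_(q, r)) :
  A *t (c *: B) = c *: (A *t B).
Proof. by apply/matrixP => i j; rewrite !mxE mulrCA. Qed.
Lemma tensDl m p q r (A A' : 'M[K]_(m, p)) (B : 'M[K]_(q, r)) :
  (A + A') *t B = A *t B + A' *t B.
Proof. by apply/matrixP => i j; rewrite !mxE mulrDl. Qed.
Lemma tensDr m p q r (A : 'M[K]_(m, p)) (B B' : 'M[K]_(q, r)) :
  A *t (B + B') = A *t B + A *t B'.
Proof. by apply/matrixP => i j; rewrite !mxE mulrDr. Qed.
Lemma tensNl m p q r (A : 'M[K]_(m, p)) (B : 'M[K]_(q, r)) :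
  (- A) *t B = - (A *t B).
Proof. by apply/matrixP => i j; rewrite !mxE mulNr. Qed.
Lemma tensNr m p q r (A : 'M[K]_(m, p)) (B : 'M[K]_(q, r)) :
  A *t (- B) = - (A *t B).
Proof. by apply/matrixP => i j; rewrite !mxE mulrN. Qed.

Section Comm.
Variables (m : nat) (h : ugen n -> 'M[K]_m).
Hypothesis H : U_mxrel v h.

Lemma mx_keC i j : h (Uk i) *m h (Ue j) = v ^ cartan i j *: (h (Ue j) *m h (Uk i)).
Proof. by rewrite scalemxAl -(mx_ke H) -[RHS]mulmxA (mx_kik H) mulmx1. Qed.
Lemma mx_kfC i j :
  h (Uk i) *m h (Uf j) = v ^ (- cartan i j) *: (h (Uf j) *m h (Uk i)).
Proof. by rewrite scalemxAl -(mx_kf H) -[RHS]mulmxA (mx_kik H) mulmx1. Qed.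
Lemma mx_ekiC i j :
  h (Ue j) *m h (Uki i) = v ^ cartan i j *: (h (Uki i) *m h (Ue j)).
Proof.
by rewrite scalemxAr -(mx_ke H) !mulmxA (mx_kik H) mul1mx.
Qed.
Lemma mx_fkiC i j :
  h (Uf j) *m h (Uki i) = v ^ (- cartan i j) *: (h (Uki i) *m h (Uf j)).
Proof.
by rewrite scalemxAr -(mx_kf H) !mulmxA (mx_kik H) mul1mx.
Qed.
Lemma mx_kifC i j :
  h (Uki i) *m h (Uf j) = v ^ cartan i j *: (h (Uf j) *m h (Uki i)).
Proof. by rewrite mx_fkiC scalerA -expfzDr // subrr expr0z scale1r. Qed.
Lemma mx_kieC i j :
  h (Uki i) *m h (Ue j) = v ^ (- cartan i j) *: (h (Ue j) *m h (Uki i)).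
Proof. by rewrite mx_ekiC scalerA -expfzDr // addNr expr0z scale1r. Qed.
Lemma mx_invC (a b x : 'M[K]_m) :
  a *m b = 1%:M -> b *m a = 1%:M -> a *m x = x *m a -> b *m x = x *m b.
Proof.
move=> ab ba ax; rewrite -[LHS]mulmx1 -ab -mulmxA [x *m _]mulmxA -ax.
by rewrite !mulmxA ba mul1mx.
Qed.
Lemma mx_kkiC i j : h (Uk i) *m h (Uki j) = h (Uki j) *m h (Uk i).
Proof.
by apply/esym/(mx_invC (mx_kki H j) (mx_kik H j))/(mx_kk H).
Qed.
Lemma mx_kikiC i j : h (Uki i) *m h (Uki j) = h (Uki j) *m h (Uki i).
Proof. exact: (mx_invC (mx_kki H i) (mx_kik H i) (mx_kkiC i j)). Qed.

End Comm.

Lemma cartanC m (i j : 'I_m) : cartan i j = cartan j i.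
Proof. by rewrite /cartan eq_sym /adjacent orbC. Qed.
Lemma cartan_adj m (i j : 'I_m) : adjacent i j -> cartan i j = -1.
Proof.
rewrite /cartan => a; case: eqP a => [->|_ ->//].
by rewrite /adjacent orbb eqn_leq ltnn andbF.
Qed.
Lemma cartan_nadj m (i j : 'I_m) : i != j -> ~~ adjacent i j -> cartan i j = 0.
Proof. by rewrite /cartan => /negPf -> /negPf ->. Qed.
Lemma cartan_diag m (i : 'I_m) : cartan i i = 2.
Proof. by rewrite /cartan eqxx. Qed.

Section Rho.
Variables (p q : nat) (X : ugen n -> 'M[K]_p) (Y : option (ugen n) -> 'M[K]_q).
Hypotheses (HX : U_mxrel v X) (HY : MU_mxrel v Y).
Let HYU := mx_U HY.
Let Ykk i j : Y (Some (Uk i)) *m Y (Some (Uk j)) =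
  Y (Some (Uk j)) *m Y (Some (Uk i)).
Proof. exact: (mx_kk HYU). Qed.
Let YkeC i j : Y (Some (Uk i)) *m Y (Some (Ue j)) =
  v ^ cartan i j *: (Y (Some (Ue j)) *m Y (Some (Uk i))).
Proof. exact: (mx_keC HYU). Qed.

(* The images of the generators under rho, acting on the tensor product of the
   spaces on which X and Y act. *)
Definition rho_gen (g : option (ugen n)) : 'M[K]_(p * q) :=
  match g with
  | Some (Ue i) => 1%:M *t Y (Some (Ue i)) + X (Ue i) *t Y (Some (Uk i))
  | Some (Uf i) => X (Uki i) *t Y (Some (Uf i)) + X (Uf i) *t 1%:M
  | Some (Uk i) => X (Uk i) *t Y (Some (Uk i))
  | Some (Uki i) => X (Uki i) *t Y (Some (Uki i))
  | None => 1%:M *t Y None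
  end.

Let mulE := (mulmxDl, mulmxDr, tensmx_mul, mul1mx, mulmx1).

Lemma rho_U : U_mxrel v (fun u => rho_gen (Some u)).
Proof.
split=> [i|i|i j|i j|i j|i j|i j|i j|i j a|i j a] /=.
- by rewrite tensmx_mul (mx_kki HX) (mx_kki HYU) tens1.
- by rewrite tensmx_mul (mx_kik HX) (mx_kik HYU) tens1.
- by rewrite !tensmx_mul (mx_kk HX) Ykk.
- rewrite !mulE (mx_kki HX) (mx_ke HX) (mx_ke HYU).
  by rewrite Ykk -(mulmxA _ _ (Y (Some (Uki i)))) (mx_kki HYU)
    mulmx1 tensZl tensZr -scalerDr.
- rewrite !mulE (mx_kki HYU) (mx_kf HX) (mx_kf HYU).
  by rewrite (mx_kkiC HX) -(mulmxA _ _ (X (Uki i))) (mx_kki HX)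
    mulmx1 tensZl tensZr -scalerDr.
- rewrite !mulE (mx_ekiC HX) (mx_kfC HYU) tensZl tensZr scalerA cartanC.
  rewrite -expfzDr // subrr expr0z scale1r.
  transitivity (X (Uki j) *t (Y (Some (Ue i)) *m Y (Some (Uf j))
       - Y (Some (Uf j)) *m Y (Some (Ue i)))
    + (X (Ue i) *m X (Uf j) - X (Uf j) *m X (Ue i)) *t Y (Some (Uk i))).
    rewrite tensDr tensDl tensNl tensNr.
    set A := _ *t _; set B := _ *t _; set C := _ *t _; set D := _ *t _;
    set A' := _ *t _; set B' := _ *t _.
    by apply/matrixP => k l; rewrite !mxE; ring.
  rewrite (mx_ef HX) (mx_ef HYU); case: eqP => [<-|_]; last first.
    by rewrite tensmx0 tens0mx addr0.
  rewrite tensZl tensZr -scalerDr tensDl tensDr tensNl tensNr.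
  by congr (_ *: _); rewrite addrC addrA subrK.
- case: (eqVneq i j) => [->//|ij na].
  have cij := cartan_nadj ij na; have cji : cartan j i = 0 by rewrite cartanC.
  rewrite !mulE (mx_ee HX na) (mx_ee HYU na) (Ykk i j).
  rewrite (YkeC i) (YkeC j) cij cji !scale1r.
  by rewrite -!addrA; congr (_ + _); rewrite addrCA.
- case: (eqVneq i j) => [->//|ij na].
  have cij := cartan_nadj ij na; have cji : cartan j i = 0 by rewrite cartanC.
  rewrite !mulE (mx_ff HX na) (mx_ff HYU na) (mx_kikiC HX i j).
  rewrite (mx_kifC HX i) (mx_kifC HX j) cij cji !scale1r.
  by rewrite -!addrA; congr (_ + _); rewrite addrCA.
- have cij := cartan_adj a; have cji : cartan j i = -1 by rewrite cartanC.
  apply: serre_sum; rewrite !mulE.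
  + by rewrite YkeC cartan_diag tensZr.
  + by rewrite YkeC cij tensZr.
  + by rewrite YkeC cji tensZr.
  + by rewrite -tensZr (mx_serre_e HYU a) tensDr.
  + rewrite -tensZl (mx_serre_e HX a) tensDl; congr (_ *t _ + _ *t _).
      by rewrite -!mulmxA (Ykk i j).
    by rewrite (Ykk i j) -mulmxA.
- have cij := cartan_adj a; have cji : cartan j i = -1 by rewrite cartanC.
  rewrite ![X (Uki _) *t _ + _]addrC.
  apply: serre_sum; rewrite !mulE.
  + by rewrite (mx_kifC HX) cartan_diag tensZl.
  + by rewrite (mx_kifC HX) cij tensZl.
  + by rewrite (mx_kifC HX) cji tensZl.
  + by rewrite -tensZl (mx_serre_f HX a) tensDl.
  + rewrite -tensZr (mx_serre_f HYU a) tensDr; congr (_ *t _ + _ *t _).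
      by rewrite -!mulmxA (mx_kikiC HX i j).
    by rewrite (mx_kikiC HX i j) -mulmxA.
Qed.

Lemma rho_MU : MU_mxrel v rho_gen.
Proof.
split=> [||i|i a|i a|i a|i a|i a|i a] /=.
- exact: rho_U.
- by rewrite !mulE (mx_ll HY).
- by rewrite !mulE (mx_kl HY).
- by rewrite !mulE (mx_kl HY) (mx_le HY a).
- by rewrite !mulE (mx_lf HY a).
- rewrite !mulE (mx_lel HY a) -mulmxA (mx_kl HY) mulmxA (mx_ll HY).
  by [].
- by rewrite !mulE (mx_lfl HY a) (mx_ll HY).
- apply: ele_sum; rewrite !mulE.
  + by rewrite YkeC cartan_diag tensZr.
  + by rewrite (mx_kl HY).
  + by rewrite -tensZr (mx_ele HY a) tensDr !tensZr.
- rewrite [X (Uki _) *t _ + _]addrC; apply: flf_sum; rewrite !mulE.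
  + by rewrite (mx_kifC HX) cartan_diag tensZl.
  + by [].
  + by rewrite -tensZr (mx_flf HY a) tensDr !tensZr.
Qed.

End Rho.

Definition tens_rep (V : rep (Uq v n)) (W : rep (MUq v n)) : rep (MUq v n) :=
  MU_rep (rho_MU (U_mxrelP V) (MU_mxrelP W)).

End Tensor.

Section Wedge.
Variables (K : fieldType) (v : K) (n r : nat).
Hypotheses (v_neq0 : v != 0) (v_sub_neq0 : v - v^-1 != 0).

Lemma hi_subproof (i : 'I_n.-1) : (i.+1 < n)%N.
Proof. by case: i => i; case: n. Qed.

Definition lo (i : 'I_n.-1) : 'I_n := widen_ord (leq_pred n) i.
Definition hi (i : 'I_n.-1) : 'I_n := Ordinal (hi_subproof i).

Definition subsets : {set {set 'I_n}} := [set I : {set 'I_n} | #|I| == r].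

Definition basis_set (a : 'I_#|subsets|) : {set 'I_n} := enum_val a.

(* The basis vector u_I; it is 0 when I does not have r elements. *)
Definition wvec (I : {set 'I_n}) : 'cV[K]_#|subsets| :=
  \col_a (basis_set a == I)%:R.

(* The action of k_i for x = v, and of its inverse for x = v^-1. *)
Definition wk (x : K) (i : 'I_n.-1) (I : {set 'I_n}) : 'cV[K]_#|subsets| :=
  if (lo i \in I) && (hi i \notin I) then x *: wvec I
  else if (lo i \notin I) && (hi i \in I) then x^-1 *: wvec I
  else wvec I.

Definition we (i : 'I_n.-1) (I : {set 'I_n}) : 'cV[K]_#|subsets| :=
  if (hi i \in I) && (lo i \notin I) then wvec (lo i |: (I :\ hi i)) else 0.

Definition wf (i : 'I_n.-1) (I : {set 'I_n}) : 'cV[K]_#|subsets| :=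
  if (lo i \in I) && (hi i \notin I) then wvec (hi i |: (I :\ lo i)) else 0.

Definition wl (I : {set 'I_n}) : 'cV[K]_#|subsets| :=
  if [exists x in I, val x == 0%N] then 0 else wvec I.

Definition wedge_act (g : option (ugen n)) : {set 'I_n} -> 'cV[K]_#|subsets| :=
  match g with
  | Some (Ue i) => we i
  | Some (Uf i) => wf i
  | Some (Uk i) => wk v i
  | Some (Uki i) => wk v^-1 i
  | None => wl
  end.

Definition wedge_mx (g : option (ugen n)) : 'M[K]_#|subsets| :=
  \matrix_(a, b) wedge_act g (basis_set b) a 0.

Lemma wvecE (A B : 'M[K]_#|subsets|) :
  (forall I : {set 'I_n}, #|I| = r -> A *m wvec I = B *m wvec I) -> A = B.
Proof.
move=> AB; apply/matrixP => a b.
have := AB (basis_set b) _; have /[!inE]/eqP h := enum_valP b.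
move=> /(_ h)/matrixP/(_ a 0); rewrite !mxE.
rewrite (bigD1 b) //= mxE eqxx mulr1 big1 ?addr0.
  rewrite (bigD1 b) //= mxE eqxx mulr1 big1 ?addr0 // => c cb.
  by rewrite mxE (inj_eq enum_val_inj) (negPf cb) mulr0.
by move=> c cb; rewrite mxE (inj_eq enum_val_inj) (negPf cb) mulr0.
Qed.

Lemma wedge_mxE g (I : {set 'I_n}) : #|I| = r -> wedge_mx g *m wvec I = wedge_act g I.
Proof.
move=> cI; have Is : I \in subsets by rewrite inE cI.
apply/colP => a; rewrite !mxE (bigD1 (enum_rank_in Is I)) //= big1 ?addr0.
  by rewrite !mxE /basis_set enum_rankK_in // eqxx mulr1.
move=> c cb; rewrite !mxE /basis_set; case: eqP => [h|]; last by rewrite mulr0.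
by case/eqP: cb; apply: enum_val_inj; rewrite enum_rankK_in.
Qed.

Lemma card_we i (I : {set 'I_n}) : hi i \in I -> lo i \notin I ->
  #|lo i |: (I :\ hi i)| = #|I|.
Proof.
by move=> h l; rewrite cardsU1 !inE (negPf l) andbF (cardsD1 (hi i) I) h.
Qed.
Lemma card_wf i (I : {set 'I_n}) : lo i \in I -> hi i \notin I ->
  #|hi i |: (I :\ lo i)| = #|I|.
Proof.
by move=> h l; rewrite cardsU1 !inE (negPf l) andbF (cardsD1 (lo i) I) h.
Qed.

Local Notation E i := (wedge_mx (Some (Ue i))).
Local Notation F i := (wedge_mx (Some (Uf i))).
Local Notation k i := (wedge_mx (Some (Uk i))).
Local Notation ki i := (wedge_mx (Some (Uki i))).
Local Notation l := (wedge_mx None).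

Lemma lo_hi i : (lo i == hi i) = false.
Proof. by apply/eqP => /(congr1 val) /= /eqP; rewrite eqn_leq ltnn andbF. Qed.
Lemma hi_lo i : (hi i == lo i) = false.
Proof. by rewrite eq_sym lo_hi. Qed.
Lemma lo_eq i j : (lo i == lo j) = (i == j). Proof. by []. Qed.
Lemma hi_eq i j : (hi i == hi j) = (i == j).
Proof. by rewrite -val_eqE /= eqSS. Qed.

Let c x i (I : {set 'I_n}) : K :=
  if (lo i \in I) && (hi i \notin I) then x
  else if (lo i \notin I) && (hi i \in I) then x^-1 else 1.

Lemma wkE x i I : wk x i I = c x i I *: wvec I.
Proof. by rewrite /wk /c; case: ifP => // _; case: ifP => // _; rewrite scale1r. Qed.

Lemma actK i (I : {set 'I_n}) : #|I| = r -> k i *m wvec I = c v i I *: wvec I.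
Proof. by move=> h; rewrite wedge_mxE //= wkE. Qed.
Lemma actKi i (I : {set 'I_n}) : #|I| = r -> ki i *m wvec I = c v^-1 i I *: wvec I.
Proof. by move=> h; rewrite wedge_mxE //= wkE. Qed.
Lemma cV i I : c v i I * c v^-1 i I = 1.
Proof. by rewrite /c; do 2?case: ifP => _; rewrite ?mulr1 ?invrK ?mulfV ?mulVf. Qed.
Lemma cV' i I : c v^-1 i I = (c v i I)^-1.
Proof. by rewrite /c; do 2?case: ifP => _; rewrite ?invr1. Qed.
Lemma actE i (I : {set 'I_n}) : #|I| = r -> E i *m wvec I =
  if (hi i \in I) && (lo i \notin I) then wvec (lo i |: (I :\ hi i)) else 0.
Proof. by move=> h; rewrite wedge_mxE. Qed.
Lemma actF i (I : {set 'I_n}) : #|I| = r -> F i *m wvec I =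
  if (lo i \in I) && (hi i \notin I) then wvec (hi i |: (I :\ lo i)) else 0.
Proof. by move=> h; rewrite wedge_mxE. Qed.
Lemma actL (I : {set 'I_n}) : #|I| = r -> l *m wvec I =
  if [exists x in I, val x == 0%N] then 0 else wvec I.
Proof. by move=> h; rewrite wedge_mxE. Qed.

Lemma cE x i (I : {set 'I_n}) :
  c x i I = x ^ ((lo i \in I)%:Z - (hi i \in I)%:Z).
Proof. by rewrite /c; case: (lo i \in I); case: (hi i \in I). Qed.

Lemma mem_move (x a b : 'I_n) (I : {set 'I_n}) : a \in I -> b \notin I ->
  (x \in b |: (I :\ a))%:Z = (x \in I)%:Z + (x == b)%:Z - (x == a)%:Z :> int.
Proof.
move=> aI bI; rewrite !inE.
case: (eqVneq x b) => [->|xb] /=; case: (eqVneq _ a) => [xa|xa] /=.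
- by rewrite -xa (negPf bI) in aI.
- by rewrite (negPf bI).
- by rewrite xa aI.
- by rewrite addr0 subr0.
Qed.

Lemma cartanE (i j : 'I_n.-1) : cartan i j =
  (lo i == lo j)%:Z - (lo i == hi j)%:Z - (hi i == lo j)%:Z + (hi i == hi j)%:Z.
Proof.
rewrite lo_eq hi_eq /cartan /adjacent -!val_eqE /=.
rewrite (eq_sym i.+1).
by case: eqP => ?; case: eqP => ?; case: eqP => ? /=; lia.
Qed.

Lemma c_move x i (a b : 'I_n) (I : {set 'I_n}) : x != 0 ->
  a \in I -> b \notin I ->
  c x i (b |: (I :\ a)) = x ^ ((lo i == b)%:Z - (lo i == a)%:Z -
    (hi i == b)%:Z + (hi i == a)%:Z) * c x i I.
Proof.
move=> x0 aI bI; rewrite !cE !mem_move // -expfzDr //; congr (_ ^ _); ring.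
Qed.

Lemma EE i : E i *m E i = 0.
Proof.
apply: wvecE => I h; rewrite -mulmxA mul0mx actE //.
case: ifP => [/andP[hj lj]|_]; last by rewrite mulmx0.
by rewrite actE ?card_we // !(inE, eqxx, lo_hi, hi_lo).
Qed.
Lemma FF i : F i *m F i = 0.
Proof.
apply: wvecE => I h; rewrite -mulmxA mul0mx actF //.
case: ifP => [/andP[hj lj]|_]; last by rewrite mulmx0.
by rewrite actF ?card_wf // !(inE, eqxx, lo_hi, hi_lo).
Qed.
Lemma EEE i j : adjacent i j -> E i *m E j *m E i = 0.
Proof.
move=> a; apply: wvecE => I h; rewrite -!mulmxA mul0mx actE //.
case: ifP => [/andP[hI lI]|_]; last by rewrite !mulmx0.
rewrite actE ?card_we //; case: ifP => [/andP[hj lj]|_]; last by rewrite !mulmx0.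
rewrite actE ?card_we // ifF //; apply/negP.
move: a hj lj; rewrite !inE -!val_eqE /= /adjacent; lia.
Qed.
Lemma FFF i j : adjacent i j -> F i *m F j *m F i = 0.
Proof.
move=> a; apply: wvecE => I h; rewrite -!mulmxA mul0mx actF //.
case: ifP => [/andP[hI lI]|_]; last by rewrite !mulmx0.
rewrite actF ?card_wf //; case: ifP => [/andP[hj lj]|_]; last by rewrite !mulmx0.
rewrite actF ?card_wf // ifF //; apply/negP.
move: a hj lj; rewrite !inE -!val_eqE /= /adjacent; lia.
Qed.

Lemma if_wvec (b b' : bool) (I J : {set 'I_n}) :
  b = b' -> (b -> I =i J) ->
  (if b then wvec I else 0) = (if b' then wvec J else 0).
Proof. by move=> <-; case: b => // /(_ isT)/setP->. Qed.

Lemma actEF i j (I : {set 'I_n}) : #|I| = r -> E i *m F j *m wvec I =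
  let J := hi j |: (I :\ lo j) in
  if ((lo j \in I) && (hi j \notin I)) && ((hi i \in J) && (lo i \notin J))
  then wvec (lo i |: (J :\ hi i)) else 0.
Proof.
move=> h; rewrite -mulmxA actF //; case: ifP => [/andP[x y]|_] /=.
  by rewrite actE ?card_wf.
by rewrite mulmx0.
Qed.
Lemma actFE i j (I : {set 'I_n}) : #|I| = r -> F i *m E j *m wvec I =
  let J := lo j |: (I :\ hi j) in
  if ((hi j \in I) && (lo j \notin I)) && ((lo i \in J) && (hi i \notin J))
  then wvec (hi i |: (J :\ lo i)) else 0.
Proof.
move=> h; rewrite -mulmxA actE //; case: ifP => [/andP[x y]|_] /=.
  by rewrite actF ?card_we.
by rewrite mulmx0.
Qed.
Lemma actEE i j (I : {set 'I_n}) : #|I| = r -> E i *m E j *m wvec I =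
  let J := lo j |: (I :\ hi j) in
  if ((hi j \in I) && (lo j \notin I)) && ((hi i \in J) && (lo i \notin J))
  then wvec (lo i |: (J :\ hi i)) else 0.
Proof.
move=> h; rewrite -mulmxA actE //; case: ifP => [/andP[x y]|_] /=.
  by rewrite actE ?card_we.
by rewrite mulmx0.
Qed.
Lemma actFF i j (I : {set 'I_n}) : #|I| = r -> F i *m F j *m wvec I =
  let J := hi j |: (I :\ lo j) in
  if ((lo j \in I) && (hi j \notin I)) && ((lo i \in J) && (hi i \notin J))
  then wvec (hi i |: (J :\ lo i)) else 0.
Proof.
move=> h; rewrite -mulmxA actF //; case: ifP => [/andP[x y]|_] /=.
  by rewrite actF ?card_wf.
by rewrite mulmx0.
Qed.

Lemma EFC i j : i != j -> E i *m F j = F j *m E i.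
Proof.
move=> ij; apply: wvecE => I h; rewrite actEF // actFE //=.
apply: if_wvec => [|c' x]; rewrite !inE -!val_eqE /= in ij *; first lia.
by case: (x \in I); lia.
Qed.

Lemma EEC i j : ~~ adjacent i j -> E i *m E j = E j *m E i.
Proof.
case: (eqVneq i j) => [->//|ij a]; apply: wvecE => I h; rewrite !actEE //=.
rewrite /adjacent in a.
apply: if_wvec => [|c' x]; rewrite !inE -!val_eqE /= in ij a *; first lia.
by case: (x \in I); lia.
Qed.

Lemma FFC i j : ~~ adjacent i j -> F i *m F j = F j *m F i.
Proof.
case: (eqVneq i j) => [->//|ij a]; apply: wvecE => I h; rewrite !actFF //=.
rewrite /adjacent in a.
apply: if_wvec => [|c' x]; rewrite !inE -!val_eqE /= in ij a *; first lia.
by case: (x \in I); lia.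
Qed.

Lemma set_moveK (a b : 'I_n) (I : {set 'I_n}) : a \in I -> b \notin I ->
  a |: ((b |: (I :\ a)) :\ b) = I.
Proof.
move=> aI bI; apply/setP => x; rewrite !inE.
case: (eqVneq x a) => [->//|xa]; case: (eqVneq x b) => [->|xb] //=.
by rewrite (negPf bI).
Qed.

Lemma EF_FE i : E i *m F i - F i *m E i = (v - v^-1)^-1 *: (k i - ki i).
Proof.
apply: wvecE => I h; rewrite -scalemxAl !mulmxBl actEF // actFE //=.
rewrite actK // actKi // cV' /c !inE !eqxx lo_hi hi_lo /=.
rewrite -scalerBl scalerA.
case: (boolP (lo i \in I)) => lI; case: (boolP (hi i \in I)) => hI /=;
  rewrite ?invr1 ?invrK ?subr0 ?sub0r ?subrr ?mulr0 ?scale0r //.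
- by rewrite set_moveK // mulVf // scale1r.
- by rewrite set_moveK // -[v^-1 - v]opprB mulrN mulVf // scaleN1r.
Qed.

Lemma wedge_U : U_mxrel v (fun u => wedge_mx (Some u)).
Proof.
split.
- move=> i; apply: wvecE => I h; rewrite -mulmxA actKi // -scalemxAr actK //.
  by rewrite scalerA mulrC cV scale1r mul1mx.
- move=> i; apply: wvecE => I h; rewrite -mulmxA actK // -scalemxAr actKi //.
  by rewrite scalerA cV scale1r mul1mx.
- move=> i j; apply: wvecE => I h.
  rewrite -!mulmxA !actK // -!scalemxAr !actK //.
  by rewrite !scalerA mulrC.
- move=> i j; apply: wvecE => I h.
  rewrite -!mulmxA -scalemxAl actKi // -scalemxAr actE // -scalemxAr.
  case: ifP => [/andP[hj lj]|_]; last by rewrite mulmx0 !scaler0.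
  rewrite actK ?card_we // scalerA; congr (_ *: _).
  rewrite c_move // mulrCA [c v^-1 i I * _]mulrC cV mulr1; congr (_ ^ _).
  by rewrite cartanE; ring.
- move=> i j; apply: wvecE => I h.
  rewrite -!mulmxA -scalemxAl actKi // -scalemxAr actF // -scalemxAr.
  case: ifP => [/andP[hj lj]|_]; last by rewrite mulmx0 !scaler0.
  rewrite actK ?card_wf // scalerA; congr (_ *: _).
  rewrite c_move // mulrCA [c v^-1 i I * _]mulrC cV mulr1; congr (_ ^ _).
  by rewrite cartanE; ring.
- by move=> i j; case: eqVneq => [<-|ij]; [exact: EF_FE|rewrite EFC // subrr].
- exact: EEC.
- exact: FFC.
- by move=> i j a; rewrite EEE // EE mul0mx mulmx0 addr0 scaler0.
- by move=> i j a; rewrite FFF // FF mul0mx mulmx0 addr0 scaler0.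
Qed.

Lemma wedge_ll : l *m l = l.
Proof.
apply: wvecE => I h; rewrite -mulmxA actL //; case: ifP => e.
  by rewrite mulmx0.
by rewrite actL // e.
Qed.

Lemma has_first (i : 'I_n.-1) (I : {set 'I_n}) : i = 0%N :> nat ->
  [exists x in I, val x == 0%N] = (lo i \in I).
Proof.
move=> i0; apply/existsP/idP => [[x /andP[xI /eqP x0]]|h].
  by have -> : lo i = x by apply: val_inj; rewrite /= x0.
by exists (lo i); rewrite h /= i0.
Qed.

Lemma has_first_move (a b : 'I_n) (I : {set 'I_n}) :
  (0 < a)%N -> (0 < b)%N ->
  [exists x in b |: (I :\ a), val x == 0%N] = [exists x in I, val x == 0%N].
Proof.
move=> a0 b0; apply/eq_existsb => x; rewrite !inE.
case: (eqVneq (val x) 0%N) => x0; rewrite ?andbF // !andbT.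
by rewrite -!val_eqE /= x0; move: a0 b0; case: (_ \in I); lia.
Qed.

Lemma wedge_lE (i : 'I_n.-1) : i = 0%N :> nat -> l *m E i = 0.
Proof.
move=> i0; apply: wvecE => I h; rewrite -mulmxA mul0mx actE //.
case: ifP => [/andP[x y]|_]; last by rewrite mulmx0.
by rewrite actL ?card_we // (has_first _ i0) !inE eqxx.
Qed.

Lemma wedge_Fl (i : 'I_n.-1) : i = 0%N :> nat -> F i *m l = 0.
Proof.
move=> i0; apply: wvecE => I h; rewrite -mulmxA mul0mx actL //.
rewrite (has_first _ i0); case: ifP => x; first by rewrite mulmx0.
by rewrite actF // x.
Qed.

Lemma wedge_MU : MU_mxrel v wedge_mx.
Proof.
split=> [||i|i a|i a|i a|i a|i a|i a].
- exact: wedge_U.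
- exact: wedge_ll.
- apply: wvecE => I h; rewrite -!mulmxA actL // actK // -scalemxAr actL //.
  by case: ifP => _; rewrite ?mulmx0 ?scaler0 ?actK.
- apply: wvecE => I h; rewrite -!mulmxA actL // actE //.
  case: ifP => [/andP[x y]|c']; last first.
    by case: ifP => _; rewrite ?mulmx0 ?actE ?c'.
  rewrite actL ?card_we // has_first_move //; case: ifP => _.
    by rewrite mulmx0.
  by rewrite actE // x y.
- apply: wvecE => I h; rewrite -!mulmxA actL // actF //.
  case: ifP => [/andP[x y]|c']; last first.
    by case: ifP => _; rewrite ?mulmx0 ?actF ?c'.
  rewrite actL ?card_wf // has_first_move //; case: ifP => _.
    by rewrite mulmx0.
  by rewrite actF // x y.
- by rewrite wedge_lE // mul0mx.
- by rewrite -mulmxA wedge_Fl // mulmx0.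
- by rewrite -mulmxA wedge_lE // EE mul0mx !mulmx0 !scaler0 addr0.
- by rewrite wedge_Fl // FF mul0mx !mulmx0 mul0mx !scaler0 addr0.
Qed.
Definition wedge_rep : rep (MUq v n) := MU_rep wedge_MU.

End Wedge.

Section Main.
Variable R : realType.

Definition Cv : fieldType := {fraction {poly R[i]}}.
Definition vC : Cv := @tofrac {poly R[i]} 'X.

Lemma vC_neq0 : vC != 0.
Proof. by rewrite /vC tofrac_eq0 polyX_eq0. Qed.

Lemma vC_sub_neq0 : vC - vC^-1 != 0.
Proof.
apply/eqP => /(congr1 ( *%R vC)); rewrite mulr0 mulrBr mulfV ?vC_neq0 // -expr2.
move/eqP; rewrite subr_eq0 /vC -tofracXn -tofrac1 tofrac_eq => /eqP.
by move/(congr1 (fun p : {poly R[i]} => size p)); rewrite size_polyXn size_poly1.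
Qed.

Variable n : nat.

(* A weight is given by a representative in Z^n; the notions below are invariant
   under translation by (1, ..., 1). *)
Definition dominant (lam : 'I_n -> int) : Prop :=
  forall i j : 'I_n, (i <= j)%N -> (lam j <= lam i)%R.

Definition is_highest_weight_vector (lam : 'I_n -> int) (L : rep (Uq vC n))
    (x : 'cV[Cv]_(rdim L)) : Prop :=
  [/\ x != 0,
      forall i, L (Ugen vC (Ue i)) *m x = 0,
      forall i, L (Ugen vC (Uk i)) *m x = vC ^ (lam (lo i) - lam (hi i)) *: x
    & forall y, exists a, y = L a *m x].

(* L is (isomorphic to) L_lam. *)
Definition is_simple_module (lam : 'I_n -> int) (L : rep (Uq vC n)) : Prop :=
  irreducible_rep L /\ exists x : 'cV_(rdim L), is_highest_weight_vector lam x.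

Definition W (r : nat) : rep (MUq vC n) := wedge_rep n r vC_neq0 vC_sub_neq0.

Definition tensor_W (L : rep (Uq vC n)) (r : nat) : rep (MUq vC n) :=
  tens_rep vC_neq0 L (W r).

End Main.

(* Main.v *)
Require Import Defs.
From HB Require Import structures.
From mathcomp Require Import all_boot all_order all_algebra reals.
From mathcomp Require Import mxtens monalg ring zify.

(* Let A be the algebra of operators preserving a submodule S of L (x) W. The
   commutators of e_1 and f_1 with l put 1 (x) e_1 and f_1 (x) 1 in A, and
   bracketing with e_{i+1} and f_{i+1} propagates this to all indices: A
   contains every 1 (x) e_i, e_i (x) k_i, f_i (x) 1 and k_i^-1 (x) f_i. The
   operators 1 (x) e_i push a nonzero vector of S into L (x) u_top, where u_top
   spans the common kernel of the e_i on W; S then contains L (x) u_top because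
   L is irreducible, and the operators k_i^-1 (x) f_i recover all of L (x) W. *)

Set Implicit Arguments.
Unset Strict Implicit.
Unset Printing Implicit Defensive.

Import GRing.Theory.
Local Open Scope ring_scope.

(** * Operators preserving a subspace *)

Section Preserves.
Variables (K : fieldType) (m : nat) (S : {vspace 'cV[K]_m}).

Definition preserves (M : 'M[K]_m) := forall s, s \in S -> M *m s \in S.

Lemma preserves1 : preserves 1%:M.
Proof. by move=> s sS; rewrite mul1mx. Qed.

Lemma preservesD M N : preserves M -> preserves N -> preserves (M + N).
Proof. by move=> hM hN s sS; rewrite mulmxDl rpredD ?hM ?hN. Qed.

Lemma preservesZ c M : preserves M -> preserves (c *: M).
Proof. by move=> hM s sS; rewrite -scalemxAl rpredZ ?hM. Qed.

Lemma preservesN M : preserves M -> preserves (- M).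
Proof. by move=> hM; rewrite -scaleN1r; exact: preservesZ. Qed.

Lemma preservesB M N : preserves M -> preserves N -> preserves (M - N).
Proof. by move=> hM hN; apply/preservesD/preservesN. Qed.

Lemma preservesM M N : preserves M -> preserves N -> preserves (M *m N).
Proof. by move=> hM hN s sS; rewrite -mulmxA hM ?hN. Qed.

(** Since [M] is injective and [S] has finite dimension, [M] maps [S] onto [S]; hence [N] sends each
    element of [S] back into [S]. *)
Lemma preserves_inv M N : N *m M = 1%:M -> preserves M -> preserves N.
Proof.
move=> NM hM s sS.
pose f : 'End('cV[K]_m) := linfun (mulmx M).
have fE u : f u = M *m u by rewrite lfunE.
have kf : lker f == 0%VS.
  apply/lker0P => u w; rewrite !fE => /(congr1 (mulmx N)).
  by rewrite !mulmxA NM !mul1mx.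
have fS : (f @: S <= S)%VS by apply/subvP => _ /memv_imgP[u uS ->]; rewrite fE hM.
have fSE : (f @: S)%VS = S.
  by apply/eqP; rewrite eqEdim fS limg_dim_eq ?leqnn // (eqP kf) capv0.
move: sS; rewrite -{1}fSE => /memv_imgP[u uS ->].
by rewrite fE mulmxA NM mul1mx.
Qed.

End Preserves.

Lemma preserves_free_lift (K : fieldType) (G : choiceType) m
    (S : {vspace 'cV[K]_m}) (h : G -> 'M[K]_m) x :
  (forall g, preserves S (h g)) -> preserves S (free_lift h x).
Proof.
move=> hS; rewrite /free_lift; elim/big_ind: _ => [s _||w _].
- by rewrite mul0mx mem0v.
- exact: preservesD.
apply: preservesZ; rewrite /word_lift; elim/big_ind: _ => [||g _] //.
- exact: preserves1.
- exact: preservesM.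
Qed.

(** Each element of [Uq] is the class of a noncommutative polynomial in the generators, and by
    [free_lift_uniq] [L] evaluates that polynomial at the matrices of the generators. *)
Lemma preserves_Uq (K : fieldType) (v : K) n (L : rep (Uq v n))
    (S : {vspace 'cV[K]_(rdim L)}) :
  (forall g, preserves S (L (Ugen v g))) -> forall a, preserves S (L a).
Proof.
move=> hS a.
have -> : a = projU v (prepr a) by rewrite /projU preprK.
have LZ c x : (L \o @projU K v n) (c *: x) = c *: (L \o @projU K v n) x.
  by rewrite linearZ.
have := free_lift_uniq LZ (prepr a) => /= ->.
by apply: preserves_free_lift.
Qed.

(** * Brackets of neighbouring generators of U_v(sl_n) *)

Section Brackets.
Variables (K : fieldType) (v : K) (n m : nat) (h : ugen n -> 'M[K]_m).
Hypotheses (v_neq0 : v != 0) (v_sub_neq0 : v - v^-1 != 0) (H : U_mxrel v h).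
Variables i j : 'I_n.-1.
Hypothesis aij : adjacent i j.
Local Notation e i := (h (Ue i)).
Local Notation f i := (h (Uf i)).
Local Notation k i := (h (Uk i)).
Local Notation ki i := (h (Uki i)).

Let neq_ij : (i == j) = false.
Proof.
by apply/eqP => ij; move: aij; rewrite ij /adjacent orbb eqn_leq ltnn andbF.
Qed.

(** The form that [v - v^-1 != 0] takes once [field] clears denominators. *)
Let v2_neq1 : v * v - 1 != 0.
Proof.
have -> : v * v - 1 = v * (v - v^-1) by rewrite mulrBr mulfV.
by rewrite mulf_neq0.
Qed.

Let efE : e i *m f i = f i *m e i + (v - v^-1)^-1 *: (k i - ki i).
Proof. by have := mx_ef H i i; rewrite eqxx => <-; rewrite addrC subrK. Qed.

(** As [f_i] commutes with [e_j], only [[e_i, f_i]] contributes. Moving [k_i] and its inverse past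
    [e_j] produces powers of [v]; the coefficient [v] makes the terms in [e_j k_i^-1] cancel. *)
Lemma bracket_f_ee :
  f i *m (e i *m e j - v *: (e j *m e i)) -
  (e i *m e j - v *: (e j *m e i)) *m f i = e j *m k i.
Proof.
have ejfi : e j *m f i = f i *m e j.
  by apply/eqP; rewrite -subr_eq0 (mx_ef H) (eq_sym j i) neq_ij.
have eef : e i *m e j *m f i =
    f i *m e i *m e j + (v - v^-1)^-1 *: (v^-1 *: (e j *m k i) - v *: (e j *m ki i)).
  rewrite -mulmxA ejfi mulmxA efE mulmxDl -scalemxAl mulmxBl.
  by rewrite (mx_keC H) (mx_kieC v_neq0 H) (cartan_adj aij) opprK expr1z.
have eef' : e j *m e i *m f i =
    f i *m e j *m e i + (v - v^-1)^-1 *: (e j *m k i - e j *m ki i).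
  by rewrite -mulmxA efE mulmxDr -scalemxAr mulmxBr !mulmxA ejfi.
rewrite mulmxBr mulmxBl -scalemxAl -scalemxAr eef eef' !mulmxA.
move: (f i *m e i *m e j) (f i *m e j *m e i) (e j *m k i) (e j *m ki i).
move=> x1 x2 x3 x4; apply/matrixP => a b; rewrite !mxE.
by field; rewrite v_neq0.
Qed.

(** The same computation for lowering operators: here the coefficient [v^-1] makes the terms in
    [f_j k_i] cancel. *)
Lemma bracket_ff_e :
  (f j *m f i - v^-1 *: (f i *m f j)) *m e i -
  e i *m (f j *m f i - v^-1 *: (f i *m f j)) = v^-1 *: (f j *m ki i).
Proof.
have eifj : e i *m f j = f j *m e i.
  by apply/eqP; rewrite -subr_eq0 (mx_ef H) neq_ij.
have eff : e i *m f j *m f i =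
    f j *m f i *m e i + (v - v^-1)^-1 *: (f j *m k i - f j *m ki i).
  by rewrite eifj -mulmxA efE mulmxDr -scalemxAr mulmxBr !mulmxA.
have eff' : e i *m f i *m f j = f i *m f j *m e i +
    (v - v^-1)^-1 *: (v *: (f j *m k i) - v^-1 *: (f j *m ki i)).
  rewrite efE mulmxDl -mulmxA eifj mulmxA -scalemxAl mulmxBl.
  by rewrite (mx_kfC H) (mx_kifC v_neq0 H) (cartan_adj aij) opprK expr1z.
rewrite mulmxBr mulmxBl -scalemxAl -scalemxAr !mulmxA eff eff'.
move: (f j *m f i *m e i) (f i *m f j *m e i) (f j *m k i) (f j *m ki i).
move=> x1 x2 x3 x4; apply/matrixP => a b; rewrite !mxE.
by field; rewrite v_neq0.
Qed.
End Brackets.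


(** * Separating the two tensor factors *)

Section Separation.
Variables (K : fieldType) (v : K) (n p q : nat).
Variables (X : ugen n -> 'M[K]_p) (Y : option (ugen n) -> 'M[K]_q).
Hypotheses (v_neq0 : v != 0) (v_sub_neq0 : v - v^-1 != 0).
Hypotheses (HX : U_mxrel v X) (HY : MU_mxrel v Y).
Variable S : {vspace 'cV[K]_(p * q)}.
Hypothesis SP : forall g, preserves S (rho_gen X Y g).
Let HYU := mx_U HY.

Local Notation e i := (X (Ue i)).
Local Notation f i := (X (Uf i)).
Local Notation k i := (X (Uk i)).
Local Notation ki i := (X (Uki i)).
Local Notation e' i := (Y (Some (Ue i))).
Local Notation f' i := (Y (Some (Uf i))).
Local Notation k' i := (Y (Some (Uk i))).
Local Notation ki' i := (Y (Some (Uki i))).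

Let mulE := (mulmxDl, mulmxDr, tensmx_mul, mul1mx, mulmx1).

(** These are one summand of rho(e_i) and one of rho(f_i); the other summands then follow by
    subtraction. *)
Definition separated i :=
  preserves S ((1%:M : 'M_p) *t e' i) /\ preserves S (f i *t (1%:M : 'M_q)).

Lemma separated_f i : separated i -> preserves S (ki i *t f' i).
Proof.
case=> _ hf; have -> : ki i *t f' i = rho_gen X Y (Some (Uf i)) - f i *t 1%:M.
  by rewrite /= addrK.
exact: preservesB.
Qed.

Lemma separated_e i : separated i -> preserves S (e i *t k' i).
Proof.
case=> he _; have -> : e i *t k' i = rho_gen X Y (Some (Ue i)) - 1%:M *t e' i.
  by rewrite /= addrC addKr.
exact: preservesB.
Qed.

(* [e (x) k', f (x) 1] = [e, f] (x) k' *)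
Lemma separated_k i : separated i -> preserves S (k i *t ki' i).
Proof.
move=> hi; have [he hf] := hi; have he2 := separated_e hi.
(* Subtracting a multiple of the bracket from rho(k_i) leaves [k_i^-1 (x) k'_i], the inverse of the
   operator wanted. *)
apply: (@preserves_inv _ _ _ (ki i *t k' i)).
  by rewrite tensmx_mul (mx_kki HX) (mx_kik HYU) tens1.
have -> : ki i *t k' i = rho_gen X Y (Some (Uk i)) - (v - v^-1) *:
    (e i *t k' i *m (f i *t 1%:M) - f i *t 1%:M *m (e i *t k' i)).
  rewrite !mulE -tensNl -tensDl (mx_ef HX) eqxx -tensZl scalerA mulfV //.
  by rewrite scale1r /= -tensNl -tensDl opprB addrC subrK.
by apply/preservesB/preservesZ/preservesB; rewrite ?SP //; exact: preservesM.
Qed.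

(** A v-commutator with the separated operators at [i] isolates one tensor factor of rho(e_j) or
    rho(f_j); an ordinary commutator then strips off the generator at [i]. *)
Lemma separated_adjacent i j : adjacent i j -> separated i -> separated j.
Proof.
move=> aij hi; have [he hf] := hi.
have he2 := separated_e hi; have hf2 := separated_f hi; have hk := separated_k hi.
split.
(* The summand [e_j (x) k'_j] of rho(e_j) drops out because [e'_i k'_j = v k'_j e'_i]. *)
- have hb : preserves S (1%:M *t (e' i *m e' j - v *: (e' j *m e' i))).
    have -> : 1%:M *t (e' i *m e' j - v *: (e' j *m e' i)) =
        (1%:M *t e' i) *m rho_gen X Y (Some (Ue j)) -
        v *: (rho_gen X Y (Some (Ue j)) *m (1%:M *t e' i)).
      rewrite /= !mulE (mx_keC HYU) cartanC (cartan_adj aij) exprN1 !tensZr.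
      rewrite scalerDr scalerA mulfV // scale1r tensDr tensNr tensZr.
      by rewrite opprD addrACA subrr addr0.
    by apply/preservesB/preservesZ; apply: preservesM; rewrite ?SP.
  (* By [bracket_f_ee] the commutator is [k_i^-1 (x) e'_j k'_i], and the last factor undoes both
     torus elements. *)
  have -> : 1%:M *t e' j =
      (ki i *t f' i *m (1%:M *t (e' i *m e' j - v *: (e' j *m e' i))) -
       1%:M *t (e' i *m e' j - v *: (e' j *m e' i)) *m (ki i *t f' i)) *m
      (k i *t ki' i).
    rewrite !tensmx_mul mul1mx mulmx1 -tensNr -tensDr.
    rewrite (bracket_f_ee v_neq0 v_sub_neq0 HYU aij).
    by rewrite tensmx_mul (mx_kik HX) -mulmxA (mx_kki HYU) mulmx1.
  by do ![apply: preservesM | apply: preservesB].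
(* The summand [k_j^-1 (x) f'_j] of rho(f_j) drops out because [k_j^-1 f_i = v^-1 f_i k_j^-1]. *)
- have hb : preserves S ((f j *m f i - v^-1 *: (f i *m f j)) *t 1%:M).
    have -> : (f j *m f i - v^-1 *: (f i *m f j)) *t 1%:M =
        rho_gen X Y (Some (Uf j)) *m (f i *t 1%:M) -
        v^-1 *: (f i *t 1%:M *m rho_gen X Y (Some (Uf j))).
      rewrite /= !mulE (mx_kifC v_neq0 HX) cartanC (cartan_adj aij) exprN1.
      rewrite !tensZl scalerDr tensDl tensNl tensZl.
      by rewrite opprD addrACA subrr add0r.
    by apply/preservesB/preservesZ; apply: preservesM; rewrite ?SP.
  have -> : f j *t 1%:M = v *: (
      ((f j *m f i - v^-1 *: (f i *m f j)) *t 1%:M *m (e i *t k' i) -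
       e i *t k' i *m ((f j *m f i - v^-1 *: (f i *m f j)) *t 1%:M)) *m
      (k i *t ki' i)).
    rewrite !tensmx_mul mul1mx mulmx1 -tensNl -tensDl.
    rewrite (bracket_ff_e v_neq0 v_sub_neq0 HX aij).
    rewrite tensmx_mul (mx_kki HYU) -scalemxAl -mulmxA (mx_kik HX) mulmx1.
    by rewrite tensZl scalerA mulfV // scale1r.
  by apply: preservesZ; do ![apply: preservesM | apply: preservesB].
Qed.

(* [E_1, l] = 1 (x) e_1 and [l, F_1] = k_1^-1 (x) f_1 *)
Lemma separated_first (i : 'I_n.-1) :
  Y None *m e' i = 0 -> e' i *m Y None = e' i ->
  f' i *m Y None = 0 -> Y None *m f' i = f' i ->
  separated i.
Proof.
move=> le el fl lf; split.
- have -> : 1%:M *t e' i = rho_gen X Y (Some (Ue i)) *m rho_gen X Y None -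
      rho_gen X Y None *m rho_gen X Y (Some (Ue i)).
    by rewrite /= !mulE le el (mx_kl HY) tensmx0 add0r addrK.
  by apply: preservesB; apply: preservesM.
- have -> : f i *t 1%:M = rho_gen X Y (Some (Uf i)) -
     (rho_gen X Y None *m rho_gen X Y (Some (Uf i)) -
      rho_gen X Y (Some (Uf i)) *m rho_gen X Y None).
    by rewrite /= !mulE fl lf tensmx0 add0r addrK addrC addKr.
  by apply/preservesB/preservesB => //; apply: preservesM.
Qed.

Lemma separated_all :
  (forall i : 'I_n.-1, i = 0%N :> nat -> separated i) -> forall i, separated i.
Proof.
move=> h0 [x]; elim: x => [|x IH] xlt; first exact: h0.
apply: (separated_adjacent _ (IH (ltnW xlt))).
by rewrite /adjacent /= eqxx orbT.
Qed.

End Separation.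


(** * Pure tensors and coordinates in the second factor *)

Section TensorVectors.
Variables (K : fieldType) (p q : nat).
Implicit Types (y : 'cV[K]_p) (w : 'cV[K]_q) (s : 'cV[K]_(p * q)).

(** The vector [w] of the second factor comes first, so that [tensv w] is a linear map on the first
    factor. *)
Definition tensv w y : 'cV[K]_(p * q) := y *t w.

Lemma tensv_mul (M : 'M_p) (N : 'M_q) w y :
  (M *t N) *m tensv w y = tensv (N *m w) (M *m y).
Proof. exact: (tensmx_mul M N y w). Qed.

Lemma tensvE w y a b : tensv w y (mxtens_index (a, b)) 0 = y a 0 * w b 0.
Proof. by rewrite mxE mxtens_indexK /= !ord1. Qed.

Lemma tensv_is_linear w : linear (tensv w).
Proof. by move=> c y y'; rewrite /tensv tensDl tensZl. Qed.
HB.instance Definition _ w :=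
  GRing.isLinear.Build K 'cV[K]_p 'cV[K]_(p * q) *:%R (tensv w)
    (tensv_is_linear w).

Lemma tensvZ c w y : tensv (c *: w) y = c *: tensv w y.
Proof. exact: (tensZr c y w). Qed.

Definition slice s (b : 'I_q) : 'cV[K]_p := \col_a s (mxtens_index (a, b)) 0.

Lemma slice_decomp s : s = \sum_b tensv (delta_mx b 0) (slice s b).
Proof.
apply/colP => k; case: (mxtens_indexP k) => a b.
rewrite summxE (bigD1 b) //= tensvE !mxE !eqxx mulr1 big1 ?addr0 // => c cb.
by rewrite tensvE !mxE eq_sym (negPf cb) mulr0.
Qed.

Lemma slice_eq0 s : (forall b, slice s b = 0) -> s = 0.
Proof. by move=> s0; rewrite [s]slice_decomp big1 // => b _; rewrite s0 linear0. Qed.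

Lemma slice_mul (N : 'M_q) s b :
  slice ((1%:M *t N) *m s) b = \sum_c N b c *: slice s c.
Proof.
rewrite [s in LHS]slice_decomp mulmx_sumr; apply/colP => a.
rewrite !mxE !summxE; apply: eq_bigr => c _.
rewrite tensv_mul mul1mx tensvE !mxE (bigD1 c) //= !mxE !eqxx mulr1 big1.
  by rewrite addr0 mulrC.
by move=> d dc; rewrite mxE (negPf dc) mulr0.
Qed.

End TensorVectors.

(** * Combinatorics of the subsets indexing the basis of W_r *)

Section SubsetHeight.
Variables n r : nat.
Implicit Types (I J : {set 'I_n}) (i : 'I_n.-1).

Definition top_set : {set 'I_n} := [set x : 'I_n | (x < r)%N].

Lemma card_top_set : (r <= n)%N -> #|top_set| = r.
Proof.
move=> rn; rewrite -[RHS]card_ord.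
have -> : top_set = [set widen_ord rn x | x in [set: 'I_r]].
  apply/setP => x; rewrite inE; apply/idP/imsetP => [xr|[z _ ->]] //=.
  by exists (Ordinal xr); rewrite ?inE //; apply: val_inj.
by rewrite card_imset ?cardsT // => x z [xz]; exact: val_inj.
Qed.

(** The hypothesis makes [I] closed downwards, so an element [x] of [I] brings [0, ..., x] with it
    and [x < r]. Equal cardinalities turn this inclusion into an equality. *)
Lemma eq_top_set I : (r <= n)%N -> #|I| = r ->
  (forall i, hi i \in I -> lo i \in I) -> I = top_set.
Proof.
move=> rn cI down.
have dcl (m : nat) (x z : 'I_n) : (z + m)%N = x -> x \in I -> z \in I.
  elim: m x => [|m IH] x zx xI.
    by have -> : z = x by apply: val_inj; rewrite /= -zx addn0.
  have lt : ((z + m) < n.-1)%N by have := ltn_ord x; lia.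
  apply: (IH (lo (Ordinal lt))) => //; apply: down.
  by have -> : hi (Ordinal lt) = x by apply: val_inj; rewrite /= -zx addnS.
apply/eqP; rewrite eqEcard cI card_top_set // leqnn andbT.
apply/subsetP => x xI; rewrite inE -cI.
have le : (x.+1 <= n)%N by [].
have <- : #|[set widen_ord le z | z in [set: 'I_x.+1]]| = x.+1.
  by rewrite card_imset ?cardsT ?card_ord // => a z [az]; exact: val_inj.
apply/subset_leq_card/subsetP => _ /imsetP[z _ ->].
by apply: (dcl (x - z)%N x) => //=; have := ltn_ord z; lia.
Qed.

(** On W_r, every basis vector other than the top one is moved by some [e_i]. *)
Lemma raisable I : (r <= n)%N -> #|I| = r -> I != top_set ->
  exists2 i, hi i \in I & lo i \notin I.
Proof.
move=> rn cI /eqP nt.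
case: (pickP (fun i => (hi i \in I) && (lo i \notin I))) => [i /andP[]|none].
  by exists i.
case: nt; apply: eq_top_set => // i hI.
by have := none i; rewrite hI; case: (lo i \in I).
Qed.

(** Each move by some [e_i] lowers it by one; it measures both the ascent to the top vector and the
    return from it. *)
Definition height I := (\sum_(x in I) x)%N.

Lemma height_raise i I : hi i \in I -> lo i \notin I ->
  (height (lo i |: (I :\ hi i))).+1 = height I.
Proof.
move=> hI lI; rewrite /height big_setU1 ?inE ?(negPf lI) ?andbF //=.
by rewrite (big_setD1 (hi i) hI).
Qed.

(** Excludes cancellation between basis vectors when [e_i] is applied to a sum. *)
Lemma raise_inj i I J : hi i \in I -> lo i \notin I ->
  hi i \in J -> lo i \notin J ->
  lo i |: (I :\ hi i) = lo i |: (J :\ hi i) -> I = J.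
Proof.
by move=> hI lI hJ lJ e; rewrite -[I](set_moveK hI lI) e set_moveK.
Qed.

Lemma card_basis_set (b : 'I_#|subsets n r|) : #|basis_set b| = r.
Proof. by have := enum_valP b; rewrite inE => /eqP. Qed.

Lemma basis_set_surj I : #|I| = r ->
  exists b : 'I_#|subsets n r|, basis_set b = I.
Proof.
move=> cI; have Is : I \in subsets n r by rewrite inE cI.
by exists (enum_rank_in Is I); rewrite /basis_set enum_rankK_in.
Qed.

End SubsetHeight.

(** * Relations and eigenvalues special to W_r *)

Section WedgeTop.
Variables (K : fieldType) (v : K) (n r : nat).
Implicit Types (I J : {set 'I_n}) (i : 'I_n.-1).

Local Notation Y := (@wedge_mx K v n r).
Local Notation wvec := (@wvec K n r).

(** The vectors killed by [l] are those with 1 in [I], which [e_1] kills too. *)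
Lemma wedge_El i : i = 0%N :> nat ->
  Y (Some (Ue i)) *m Y None = Y (Some (Ue i)).
Proof.
move=> i0; apply: wvecE => I cI; rewrite -mulmxA actL // (has_first _ i0).
by case: ifP => // lI; rewrite mulmx0 actE // lI andbF.
Qed.

Lemma wedge_lF i : i = 0%N :> nat ->
  Y None *m Y (Some (Uf i)) = Y (Some (Uf i)).
Proof.
move=> i0; apply: wvecE => I cI; rewrite -mulmxA actF //.
case: ifP => [/andP[lI hI]|_]; last by rewrite mulmx0.
by rewrite actL ?card_wf // (has_first _ i0) !inE eqxx lo_hi.
Qed.

Lemma wvec_basis_set (b : 'I_#|subsets n r|) :
  wvec (basis_set b) = delta_mx b 0.
Proof.
apply/colP => c; rewrite !mxE /basis_set (inj_eq enum_val_inj).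
by rewrite andbT.
Qed.

Lemma wk_scalar x i I : x != 0 -> exists2 c : K, c != 0 &
  wk r x i I = c *: wvec I.
Proof.
move=> x0; rewrite /wk; case: ifP => _; first by exists x.
case: ifP => _; first by exists x^-1 => //; rewrite invr_eq0.
by exists 1; rewrite ?scale1r ?oner_eq0.
Qed.

End WedgeTop.

(** * Submodules of the tensor product and the top vector *)

Section TensorWedge.
Variables (K : fieldType) (v : K) (n r : nat).
Hypothesis rn : (r <= n)%N.
Variables (p : nat) (S : {vspace 'cV[K]_(p * #|subsets n r|)}).
Local Notation Y := (@wedge_mx K v n r).
Local Notation wvec := (@wvec K n r).
Local Notation top_set := (@top_set n r).

(* Some vector of minimal height in S is killed by every 1 (x) e_i, hence lies
   in L (x) u_top. *)
Lemma top_vector : (forall i, preserves S (1%:M *t Y (Some (Ue i)))) ->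
  S != 0%VS -> exists2 y, y != 0 & tensv (wvec top_set) y \in S.
Proof.
move=> SE Sn0.
(* [N] strictly bounds the heights of the sets occurring in [s]; the sum over all of ['I_n] gives a
   first bound. *)
have [N [s [sS sn0 sN]]] : exists N s, [/\ s \in S, s != 0 & forall b,
    slice s b != 0 -> (height (basis_set b) < N)%N].
  exists (\sum_(x : 'I_n) x).+1, (vpick S); split.
  - exact: memv_pick.
  - by rewrite vpick0.
  - move=> b _; rewrite ltnS /height [leqRHS](bigID (mem (basis_set b))) /=.
    exact: leq_addr.
elim: N s sS sn0 sN => [|N IH] s sS sn0 sN.
  case/eqP: sn0; apply: slice_eq0 => b; apply/eqP/negPn/negP => /sN.
  by rewrite ltn0.
case: (pickP (fun b => (slice s b != 0) && (basis_set b != top_set))); last first.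
  move=> none; have [b bt] := basis_set_surj (card_top_set rn).
  have sb c : c != b -> slice s c = 0.
    move=> cb; apply/eqP; have := none c; case: eqP => //= _ /negPn/eqP ct.
    by case/eqP: cb; apply: enum_val_inj; rewrite -/(basis_set c) ct -bt.
  have sE : s = tensv (wvec top_set) (slice s b).
    rewrite [LHS]slice_decomp (bigD1 b) //= big1 => [|c /sb ->].
      by rewrite addr0 -bt wvec_basis_set.
    by rewrite linear0.
  exists (slice s b); last by rewrite -sE.
  by apply: contra_neq sn0 => s0; rewrite sE s0 linear0.
move=> b /andP[sbn0 bt].
have [i hI lI] := raisable rn (card_basis_set b) bt.
have YE b' c : Y (Some (Ue i)) b' c =
    ([&& hi i \in basis_set c, lo i \notin basis_set c &
      basis_set b' == lo i |: (basis_set c :\ hi i)])%:R.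
  by rewrite mxE /= /we andbA; case: ifP => _; rewrite mxE.
apply: (IH ((1%:M *t Y (Some (Ue i))) *m s)); first exact: SE.
  have [b' b'E] : exists b' : 'I_#|subsets n r|,
      basis_set b' = lo i |: (basis_set b :\ hi i).
    by apply: basis_set_surj; rewrite card_we // card_basis_set.
  (* By [raise_inj], only the slice at [b] contributes to the slice at [b'], so the raised vector is
     nonzero. *)
  apply: contra_neq sbn0 => e.
  have : slice ((1%:M *t Y (Some (Ue i))) *m s) b' = 0.
    by rewrite e; apply/colP => a; rewrite !mxE.
  rewrite slice_mul (bigD1 b) //= big1 ?addr0 => [|c cb].
    by rewrite YE hI lI b'E eqxx scale1r.
  rewrite YE; case: and3P => [[hc lc]|]; last by rewrite scale0r.
  rewrite b'E => /eqP /(raise_inj hI lI hc lc) e'.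
  by case/eqP: cb; apply: enum_val_inj.
(* A nonzero slice of the raised vector comes from a set whose height is one more, so the bound
   drops to [N]. *)
move=> b'; rewrite slice_mul => nz.
have [c] : exists c, Y (Some (Ue i)) b' c *: slice s c != 0.
  apply/existsP; apply: contraR nz; rewrite negb_exists => /forallP z.
  by rewrite big1 // => c _; apply/eqP/negPn/z.
rewrite YE; case: and3P => [[hc lc /eqP ->]|_]; last by rewrite scale0r eqxx.
by rewrite scale1r => /sN; rewrite -(height_raise hc lc).
Qed.

(** Induction on height: [u_I] is [f_i] applied to a raised basis vector of smaller height. *)
Lemma top_generates (X : ugen n -> 'M[K]_p) : U_mxrel v X ->
  (forall i, preserves S (X (Uki i) *t Y (Some (Uf i)))) ->
  (forall y, tensv (wvec top_set) y \in S) -> S = fullv.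
Proof.
move=> HX SF St.
have all_sets N (I : {set 'I_n}) : #|I| = r -> (height I < N)%N ->
    forall y, tensv (wvec I) y \in S.
  elim: N I => // N IH I cI hN y.
  case: (eqVneq I top_set) => [->//|/(raisable rn cI) [i hI lI]].
  have cJ := card_we hI lI.
  (* The factor [k_i] on [y] compensates for the [k_i^-1] accompanying [f_i]. *)
  have := SF i (tensv (wvec (lo i |: (I :\ hi i))) (X (Uk i) *m y)).
  rewrite tensv_mul mulmxA (mx_kik HX) mul1mx actF ?cJ //.
  rewrite !inE !eqxx hi_lo /= set_moveK //; apply.
  by apply: IH; rewrite ?cJ // -ltnS height_raise.
apply/eqP; rewrite eqEsubv subvf /=; apply/subvP => s _.
rewrite [s]slice_decomp rpred_sum // => b _; rewrite -wvec_basis_set.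
by apply: (all_sets _ _ _ (leqnn _)); rewrite card_basis_set.
Qed.

End TensorWedge.

(** * Irreducibility of the tensor product *)

Lemma tensor_wedge_irreducible (K : fieldType) (v : K) n r
    (v_neq0 : v != 0) (v_sub_neq0 : v - v^-1 != 0) (L : rep (Uq v n)) :
  (r <= n)%N -> irreducible_rep L ->
  irreducible_rep (tens_rep v_neq0 L (wedge_rep n r v_neq0 v_sub_neq0)).
Proof.
move=> rn [L0 Lirr]; split.
  rewrite muln_gt0 L0 card_gt0; apply/set0Pn; exists (top_set n r).
  by rewrite inE card_top_set.
move=> S SP.
pose X g := L (Ugen v g).
pose Y g := wedge_rep n r v_neq0 v_sub_neq0 (MUgen v g).
have YE g : Y g = wedge_mx v r g by exact: MU_rep_gen.
have HX : U_mxrel v X by exact: U_mxrelP.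
have HY : MU_mxrel v Y by exact: MU_mxrelP.
have SG g : preserves S (rho_gen X Y g).
  move=> s sS; have := SP (MUgen v g) s sS.
  by rewrite [ract _ _]MU_rep_gen.
have sep i : separated X Y S i.
  apply: (separated_all v_neq0 v_sub_neq0 HX HY SG) => {}i i0.
  apply: (separated_first HY SG); rewrite !YE.
  - exact: wedge_lE.
  - exact: wedge_El.
  - exact: wedge_Fl.
  - exact: wedge_lF.
case: (eqVneq S 0%VS) => [|Sn0]; [by left | right].
have SE i : preserves S (1%:M *t wedge_mx v r (Some (Ue i))).
  by rewrite -YE; case: (sep i).
have [y yn0 yS] := top_vector rn SE Sn0.
set w := wvec _ _ _ in yS.
apply: (top_generates rn HX) => [i|].
  by rewrite -YE; exact: (separated_f SG (sep i)).
(* [T] consists of the [z] in L with [z (x) u_top] in [S]. It contains [y], so it is all of L once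
   it is shown to be a submodule. *)
pose T := (linfun (tensv w) @^-1: S)%VS.
have TE z : (z \in T) = (tensv w z \in S) by rewrite -memv_preim lfunE.
(* An operator [A (x) B] on [S] restricts to [A] on [T], up to the nonzero eigenvalue of [B] on
   [u_top], which is divided out. *)
have TS (A : 'M_(rdim L)) B c :
    c != 0 -> B *m w = c *: w -> preserves S (A *t B) -> preserves T A.
  move=> c0 Bw SAB z; rewrite !TE => /SAB.
  by rewrite tensv_mul Bw tensvZ rpredZeq (negPf c0).
have cT := card_top_set rn.
have TX g : preserves T (X g).
  case: g => i.
  - have [c c0 cw] := wk_scalar r i (top_set n r) v_neq0.
    apply: (TS _ (Y (Some (Uk i))) c c0); first by rewrite YE wedge_mxE.
    exact: (separated_e SG (sep i)).
  - apply: (TS _ 1%:M 1 (oner_neq0 _)); first by rewrite mul1mx scale1r.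
    by case: (sep i).
  - have [c c0 cw] := wk_scalar r i (top_set n r) v_neq0.
    apply: (TS _ (Y (Some (Uk i))) c c0); first by rewrite YE wedge_mxE.
    exact: (SG (Some (Uk i))).
  - have vi0 : v^-1 != 0 by rewrite invr_eq0.
    have [c c0 cw] := wk_scalar r i (top_set n r) vi0.
    apply: (TS _ (Y (Some (Uki i))) c c0); first by rewrite YE wedge_mxE.
    exact: (SG (Some (Uki i))).
case: (Lirr T (preserves_Uq TX)) => TT z; last by rewrite -TE TT memvf.
by case/eqP: yn0; apply/eqP; rewrite -memv0 -TT TE.
Qed.

Theorem proposition2p22 (R : realType) (n r : nat) (lam : 'I_n -> int)
    (L : rep (Uq (vC R) n)) :
  (2 <= n)%N -> (r <= n)%N -> dominant lam -> is_simple_module lam L ->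
  irreducible_rep (tensor_W L r).
Proof. by move=> _ rn _ [Lirr _]; exact: tensor_wedge_irreducible. Qed.
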